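(* Let $N\geq 1$ be an integer. Fusion categories over $\mathbb{C}$ with $\operatorname{Vec}(\mathbb{Z}_N)$ fusion rules are classified up to monoidal equivalence by the set $$\mathbb{Z}_N/\{p^2:p\in(\mathbb{Z}_N)^\times\},$$ i.e. the set of monoidal equivalence classes of such categories is in bijection with the set of orbits of $\mathbb{Z}_N$ under multiplication by squares of units of $\mathbb{Z}_N$.
   Context: $\mathbb{Z}_N=\mathbb{Z}/N\mathbb{Z}$ and $(\mathbb{Z}_N)^\times$ is its group of units. A fusion category has $\operatorname{Vec}(\mathbb{Z}_N)$ fusion rules if it is pointed and its group of isomorphism classes of simple (invertible) objects under $\otimes$ is isomorphic to $\mathbb{Z}_N$. *)

(* Defs.v *)
From HB Require Import structures.
From mathcomp Require Import all_boot all_order all_algebra.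
From mathcomp Require Import complex.
From mathcomp Require Import classical_sets functions reals.

Set Implicit Arguments.
Unset Strict Implicit.
Unset Printing Implicit Defensive.

Import GRing.Theory.
Local Open Scope ring_scope.

Declare Scope cat_scope.
Delimit Scope cat_scope with C.
Local Open Scope cat_scope.

Reserved Notation "g \oc f" (at level 45, left associativity).
Reserved Notation "X \ox Y" (at level 40, left associativity).
Reserved Notation "f \om g" (at level 40, left associativity).

(* Morphism spaces are finite-dimensional, since [vectType] is the structure
   of finite-dimensional vector spaces. *)
Record linCat (K : fieldType) := LinCat {
  ob :> Type;
  mor : ob -> ob -> vectType K;
  idm : forall X : ob, mor X X;
  compm : forall X Y Z : ob, mor Y Z -> mor X Y -> mor X Z;
  compm_linl : forall (X Y Z : ob) (a : K) (g g' : mor Y Z) (f : mor X Y),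
    compm (a *: g + g') f = a *: compm g f + compm g' f;
  compm_linr : forall (X Y Z : ob) (a : K) (g : mor Y Z) (f f' : mor X Y),
    compm g (a *: f + f') = a *: compm g f + compm g f';
  compm_idl : forall (X Y : ob) (f : mor X Y), compm (idm Y) f = f;
  compm_idr : forall (X Y : ob) (f : mor X Y), compm f (idm X) = f;
  compmA : forall (X Y Z W : ob) (h : mor Z W) (g : mor Y Z) (f : mor X Y),
    compm h (compm g f) = compm (compm h g) f
}.

Arguments mor {K l} X Y.
Arguments idm {K l} X.
Arguments compm {K l X Y Z} g f.
Notation "g \oc f" := (compm g f) : cat_scope.

Section LinCatTheory.
Variables (K : fieldType) (C : linCat K).
Implicit Types X Y Z : C.

Definition is_iso X Y (f : mor X Y) : Prop :=
  exists g : mor Y X, g \oc f = idm X /\ f \oc g = idm Y.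

Definition isomorphic X Y : Prop := exists f : mor X Y, is_iso f.

Definition is_zero X : Prop := idm X = 0.

Definition is_mono X Y (f : mor X Y) : Prop :=
  forall Z (g h : mor Z X), f \oc g = f \oc h -> g = h.

Definition is_epi X Y (f : mor X Y) : Prop :=
  forall Z (g h : mor Y Z), g \oc f = h \oc f -> g = h.

Definition is_kernel X Y Z (f : mor X Y) (k : mor Z X) : Prop :=
  f \oc k = 0 /\
  forall W (h : mor W X), f \oc h = 0 -> exists! u : mor W Z, k \oc u = h.

Definition is_cokernel X Y Z (f : mor X Y) (q : mor Y Z) : Prop :=
  q \oc f = 0 /\
  forall W (h : mor Y W), h \oc f = 0 -> exists! u : mor Z W, u \oc q = h.

Definition is_direct_sum n (S : 'I_n -> C) X : Prop :=
  exists (i : forall k, mor (S k) X) (p : forall k, mor X (S k)),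
    [/\ forall k, p k \oc i k = idm (S k),
        forall k l, k != l -> p l \oc i k = 0
      & \sum_(k < n) (i k \oc p k) = idm X].

(* For [n = 0], [ab_dirsum] provides a zero object. *)
Record is_abelian : Prop := IsAbelian {
  ab_dirsum : forall n (S : 'I_n -> C), exists X, is_direct_sum S X;
  ab_ker : forall X Y (f : mor X Y), exists Z (k : mor Z X), is_kernel f k;
  ab_coker : forall X Y (f : mor X Y), exists Z (q : mor Y Z), is_cokernel f q;
  ab_mono : forall X Y (f : mor X Y), is_mono f ->
    exists Z (g : mor Y Z), is_kernel g f;
  ab_epi : forall X Y (f : mor X Y), is_epi f ->
    exists Z (g : mor Z X), is_cokernel g f
}.

Definition is_simple X : Prop :=
  ~ is_zero X /\
  forall Y (f : mor Y X), is_mono f -> is_zero Y \/ is_iso f.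

Definition is_semisimple : Prop :=
  forall X, exists n (S : 'I_n -> C),
    (forall k, is_simple (S k)) /\ is_direct_sum S X.

Definition finitely_many_simples : Prop :=
  exists n (S : 'I_n -> C),
    forall X, is_simple X -> exists k, isomorphic X (S k).

End LinCatTheory.

Record monCat (K : fieldType) := MonCat {
  mon_lin :> linCat K;
  tens : mon_lin -> mon_lin -> mon_lin;
  tensm : forall X X' Y Y' : mon_lin,
    mor X X' -> mor Y Y' -> mor (tens X Y) (tens X' Y');
  munit : mon_lin;
  massoc : forall X Y Z : mon_lin,
    mor (tens (tens X Y) Z) (tens X (tens Y Z));
  massocV : forall X Y Z : mon_lin,
    mor (tens X (tens Y Z)) (tens (tens X Y) Z);
  mlunit : forall X : mon_lin, mor (tens munit X) X;
  mrunit : forall X : mon_lin, mor (tens X munit) X;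
  tensm_linl : forall (X X' Y Y' : mon_lin) (a : K)
      (f f' : mor X X') (g : mor Y Y'),
    tensm (a *: f + f') g = a *: tensm f g + tensm f' g;
  tensm_linr : forall (X X' Y Y' : mon_lin) (a : K)
      (f : mor X X') (g g' : mor Y Y'),
    tensm f (a *: g + g') = a *: tensm f g + tensm f g';
  tensm_id : forall X Y : mon_lin,
    tensm (idm X) (idm Y) = idm (tens X Y);
  tensm_comp : forall (X X' X'' Y Y' Y'' : mon_lin)
      (f' : mor X' X'') (f : mor X X') (g' : mor Y' Y'') (g : mor Y Y'),
    tensm (f' \oc f) (g' \oc g) = tensm f' g' \oc tensm f g;
  massocK : forall X Y Z : mon_lin, massocV X Y Z \oc massoc X Y Z = idm _;
  massocVK : forall X Y Z : mon_lin, massoc X Y Z \oc massocV X Y Z = idm _;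
  mlunit_iso : forall X : mon_lin, is_iso (mlunit X);
  mrunit_iso : forall X : mon_lin, is_iso (mrunit X);
  massoc_nat : forall (X X' Y Y' Z Z' : mon_lin)
      (f : mor X X') (g : mor Y Y') (h : mor Z Z'),
    massoc X' Y' Z' \oc tensm (tensm f g) h =
    tensm f (tensm g h) \oc massoc X Y Z;
  mlunit_nat : forall (X Y : mon_lin) (f : mor X Y),
    mlunit Y \oc tensm (idm munit) f = f \oc mlunit X;
  mrunit_nat : forall (X Y : mon_lin) (f : mor X Y),
    mrunit Y \oc tensm f (idm munit) = f \oc mrunit X;
  mpentagon : forall X Y Z W : mon_lin,
    massoc X Y (tens Z W) \oc massoc (tens X Y) Z W =
    tensm (idm X) (massoc Y Z W) \oc massoc X (tens Y Z) W
      \oc tensm (massoc X Y Z) (idm W);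
  mtriangle : forall X Y : mon_lin,
    tensm (idm X) (mlunit Y) \oc massoc X munit Y =
    tensm (mrunit X) (idm Y)
}.

Arguments tens {K m} X Y.
Arguments tensm {K m X X' Y Y'} f g.
Arguments munit {K m}.
Arguments massoc {K m} X Y Z.
Arguments massocV {K m} X Y Z.
Arguments mlunit {K m} X.
Arguments mrunit {K m} X.
Notation "X \ox Y" := (tens X Y) : cat_scope.
Notation "f \om g" := (tensm f g) : cat_scope.

Section MonCatTheory.
Variables (K : fieldType) (C : monCat K).
Implicit Types X Y : C.

(* [Y] is a left dual of [X], equivalently [X] is a right dual of [Y]: the two
   equations are the zigzag identities, with the unit constraints moved to the
   right-hand sides. *)
Definition is_left_dual X Y : Prop :=
  exists (ev : mor (Y \ox X) munit) (coev : mor munit (X \ox Y)),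
    mrunit X \oc (idm X \om ev) \oc massoc X Y X \oc (coev \om idm X) =
      mlunit X /\
    mlunit Y \oc (ev \om idm Y) \oc massocV Y X Y \oc (idm Y \om coev) =
      mrunit Y.

Definition is_rigid : Prop :=
  forall X, (exists Y, is_left_dual X Y) /\ (exists Y, is_left_dual Y X).

Definition is_invertible X : Prop :=
  exists Y, isomorphic (X \ox Y) munit /\ isomorphic (Y \ox X) munit.

Definition is_pointed : Prop := forall X, is_simple X -> is_invertible X.

Record is_fusion : Prop := IsFusion {
  fus_abelian : is_abelian C;
  fus_semisimple : is_semisimple C;
  fus_finite : finitely_many_simples C;
  fus_rigid : is_rigid;
  fus_unit : is_simple (munit : C)
}.

End MonCatTheory.

Record fusionCat (K : fieldType) := FusionCat {
  fus_mon :> monCat K;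
  fusP : is_fusion fus_mon
}.

Record linFunctor (K : fieldType) (C D : linCat K) := LinFunctor {
  fob :> C -> D;
  fmap : forall X Y : C, mor X Y -> mor (fob X) (fob Y);
  fmap_lin : forall (X Y : C) (a : K) (f g : mor X Y),
    fmap (a *: f + g) = a *: fmap f + fmap g;
  fmap_id : forall X : C, fmap (idm X) = idm (fob X);
  fmap_comp : forall (X Y Z : C) (g : mor Y Z) (f : mor X Y),
    fmap (g \oc f) = fmap g \oc fmap f
}.

Arguments fmap {K C D} F {X Y} f : rename.

Definition is_equivalence (K : fieldType) (C D : linCat K)
    (F : linFunctor C D) : Prop :=
  exists (G : linFunctor D C)
         (eta : forall X : C, mor X (G (F X)))
         (eps : forall Y : D, mor (F (G Y)) Y),
    [/\ forall X, is_iso (eta X),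
        forall Y, is_iso (eps Y),
        forall (X X' : C) (f : mor X X'),
          eta X' \oc f = fmap G (fmap F f) \oc eta X
      & forall (Y Y' : D) (g : mor Y Y'),
          eps Y' \oc fmap F (fmap G g) = g \oc eps Y].

Record monFunctor (K : fieldType) (C D : monCat K) := MonFunctor {
  mfun :> linFunctor C D;
  mf_tens : forall X Y : C, mor (mfun X \ox mfun Y) (mfun (X \ox Y));
  mf_unit : mor munit (mfun munit);
  mf_tens_iso : forall X Y : C, is_iso (mf_tens X Y);
  mf_unit_iso : is_iso mf_unit;
  mf_tens_nat : forall (X X' Y Y' : C) (f : mor X X') (g : mor Y Y'),
    mf_tens X' Y' \oc (fmap mfun f \om fmap mfun g) =
    fmap mfun (f \om g) \oc mf_tens X Y;
  mf_assoc : forall X Y Z : C,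
    fmap mfun (massoc X Y Z) \oc mf_tens (X \ox Y) Z
      \oc (mf_tens X Y \om idm (mfun Z)) =
    mf_tens X (Y \ox Z) \oc (idm (mfun X) \om mf_tens Y Z)
      \oc massoc (mfun X) (mfun Y) (mfun Z);
  mf_lunit : forall X : C,
    fmap mfun (mlunit X) \oc mf_tens munit X \oc (mf_unit \om idm (mfun X)) =
    mlunit (mfun X);
  mf_runit : forall X : C,
    fmap mfun (mrunit X) \oc mf_tens X munit \oc (idm (mfun X) \om mf_unit) =
    mrunit (mfun X)
}.

(* Functors between [K]-linear categories are [K]-linear, as is usual for fusion
   categories; without linearity, automorphisms of [K] would identify more
   categories. *)
Definition mon_equivalent (K : fieldType) (C D : monCat K) : Prop :=
  exists F : monFunctor C D, is_equivalence F.

(* For [N > 0] this is the set of residues modulo [N]. The library's ['Z_N] is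
   not used because it has two elements when [N = 1]. For the same reason the
   multiplication is [Zp_mul], the library's product modulo [N] on this type,
   which needs no ring structure. *)
Definition ZN (N : nat) : finZmodType := 'I_N.-1.+1.

Definition ZN_mul (N : nat) (a b : ZN N) : ZN N := Zp_mul a b.

Definition ZN_unit (N : nat) (p : ZN N) : Prop :=
  exists q : ZN N, ZN_mul p q = Zp1.

(* [deg] induces an isomorphism from the group of isomorphism classes of simple
   objects to Z_N; its values on the other objects are irrelevant. *)
Definition has_VecZN_rules (K : fieldType) (N : nat) (C : fusionCat K) : Prop :=
  is_pointed C /\
  exists deg : C -> ZN N,
    [/\ forall X Y : C, is_simple X -> is_simple Y ->
          (isomorphic X Y <-> deg X = deg Y),
        forall a : ZN N, exists2 X : C, is_simple X & deg X = a
      & forall X Y : C, is_simple X -> is_simple Y ->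
          is_simple (X \ox Y) /\ deg (X \ox Y) = deg X + deg Y].

Local Open Scope classical_set_scope.

Definition square_orbit (N : nat) (a : ZN N) : set (ZN N) :=
  [set ZN_mul (ZN_mul p p) a | p in [set p : ZN N | ZN_unit p]].

Definition square_orbits (N : nat) : set (set (ZN N)) :=
  [set square_orbit a | a in [set: ZN N]].

Arguments square_orbits N : clear implicits.

(* Classes of fusion categories are plain predicates: [fusionCat K] is too large
   for the universe of [set]. *)
Definition mon_class (K : fieldType) (C : fusionCat K) : fusionCat K -> Prop :=
  fun D => mon_equivalent C D.

Definition VecZN_classes (K : fieldType) (N : nat)
    (c : fusionCat K -> Prop) : Prop :=
  exists2 C : fusionCat K, has_VecZN_rules N C & c = mon_class C.

Arguments VecZN_classes K N : clear implicits.

(* The analogue of [set_bij] for predicates. *)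
Definition bijection_between (T U : Type) (A : T -> Prop) (B : U -> Prop)
    (f : T -> U) : Prop :=
  [/\ forall x, A x -> B (f x),
      forall x y, A x -> A y -> f x = f y -> x = y
    & forall z, B z -> exists2 x, A x & f x = z].

(* Main.v *)
Require Import Defs.
From HB Require Import structures.
From mathcomp Require Import all_boot all_order all_algebra.
From mathcomp Require Import cyclic separable cyclotomic.
From mathcomp Require Import complex classical_sets reals boolp functions.
From mathcomp Require Import ring.

Set Implicit Arguments.
Unset Strict Implicit.
Unset Printing Implicit Defensive.

Import GRing.Theory.
Local Open Scope ring_scope.
Local Open Scope cat_scope.

(** A category with the fusion rules in question is determined by its simple
    objects [X a], for [a] in Z_N, together with the associator. Choosing
    isomorphisms from [X a \ox X b] to [X (a + b)] turns the associator into a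
    scalar 3-cochain [w] (record [skeleton]); the pentagon makes it a cocycle
    ([sk_cocycle]), another choice of isomorphisms changes it by a coboundary,
    and another identification of the group of simple objects with Z_N pulls it
    back along multiplication by a unit.

    The cohomology is controlled by one number, the monodromy
    z = prod_j w(1, j, 1). It is an N-th root of unity, it is trivial on
    coboundaries, and [w] is cohomologous to the standard cocycle [std3 z],
    whose value at (a, b, c) is z to the power a times the carry of b + c
    ([cocycle_std]). The proof is explicit: seen on natural numbers, where the
    third cohomology vanishes, [w] is the coboundary of a 2-cochain given by a
    product formula, and the failure of that 2-cochain to be N-periodic is
    measured by z. Pulling back along multiplication by p replaces z by
    z^(p^2) ([monodromy_pull_std3]), whence the squares in the theorem.

    It follows that every category with these rules has some type z
    ([rules_has_type]), defined exactly up to z |-> z^(p^2) ([has_type_unique],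
    [has_type_square]) and preserved by monoidal equivalence
    ([has_type_transport]). Two further facts complete the classification.
    Categories of the same type are equivalent ([has_type_equivalent]): a linear
    functor is built by decomposing objects into simple ones and copying matrix
    entries, and its monoidal structure is forced on simple summands. Every type
    occurs ([type_realised]): finite graded bases and matrices between them, with
    the associator twisted by [std3 z], form a fusion category. Writing
    z = zeta^a for a primitive root [zeta] of order N, a class is sent to the
    set of exponents a of the types of its members. *)

(** * Third cohomology of a cyclic group *)

Section Cohomology.
Variables (K : fieldType) (n : nat).
Local Notation G := 'I_n.+1.
Implicit Types (a b c : G) (w : G -> G -> G -> K) (be : G -> G -> K).

Definition is_cocycle w : Prop :=
  (forall a b c, w a b c != 0) /\
  forall a b c d, w b c d * w a (b + c) d * w a b c
                  = w (a + b) c d * w a b (c + d).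

Definition cobound be a b c : K :=
  be b c * be a (b + c) / (be (a + b) c * be a b).

Definition std3 (z : K) a b c : K := z ^+ (a * ((b + c) %/ n.+1)).

(** The product of the values [w a j 1] over a full period of [j]. At [a = 1] it
    is the complete invariant of the cohomology class of [w]. *)
Definition monodromy w a : K := \prod_(j < n.+1) w a (inZp j) Zp1.

Lemma inZpD (i j : nat) : inZp (i + j) = inZp i + inZp j :> G.
Proof. by apply/val_inj; rewrite /= modnDm. Qed.

Lemma inZp0 : inZp 0 = 0 :> G.
Proof. by apply/val_inj; rewrite /= mod0n. Qed.

Lemma inZpN : inZp n.+1 = 0 :> G.
Proof. by apply/val_inj; rewrite /= modnn. Qed.

Lemma inZpS (i : nat) : inZp i.+1 = inZp i + Zp1 :> G.
Proof. by rewrite -inZpD addn1. Qed.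

Section Splitting.
Variable w : G -> G -> G -> K.
Hypothesis cw : is_cocycle w.

(** The 2-cochain whose coboundary is [w] once the second argument is a natural
    number. The recursion in [m] is what the coboundary equation demands at
    [c = 1]; the initial value [(w a 0 0)^-1] gives the equation at [c = 0] for a
    cocycle that need not be normalised. *)
Definition splitting a (m : nat) : K :=
  (w a 0 0)^-1 * \prod_(j < m) w a (inZp j) Zp1.

Lemma splittingS a m :
  splitting a m.+1 = splitting a m * w a (inZp m) Zp1.
Proof. by rewrite /splitting big_ord_recr /= mulrA. Qed.

Lemma splitting_neq0 a m : splitting a m != 0.
Proof.
case: cw => w0 _; rewrite mulf_neq0 ?invr_eq0 ?w0 //.
by apply/prodf_neq0 => j _; apply: w0.
Qed.

(** By induction on [c], each step being the cocycle identity at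
    [(a, b, c, 1)]. *)
Lemma splittingP a (b c : nat) :
  w a (inZp b) (inZp c) * (splitting (a + inZp b) c * splitting a b)
  = splitting (inZp b) c * splitting a (b + c).
Proof.
case: cw => w0 wc; elim: c => [|c IH].
  rewrite inZp0 addn0 /splitting !big_ord0 !mulr1 mulrA; congr (_ * _).
  have := wc a (inZp b) 0 0; rewrite !addr0 => /(mulIf (w0 _ _ _)) <-.
  rewrite invfM mulrC -mulrA mulVf ?w0 // mulr1 //.
rewrite addnS !splittingS inZpS [inZp (b + c)]inZpD.
rewrite [RHS]mulrACA -IH.
have := wc a (inZp b) (inZp c) Zp1 => E.
transitivity (w (a + inZp b) (inZp c) Zp1 * w a (inZp b) (inZp c + Zp1) *
   (splitting (a + inZp b) c * splitting a b)); first by ring.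
by rewrite -E; ring.
Qed.

Lemma splittingDN a m : splitting a (m + n.+1) = splitting a m * monodromy w a.
Proof.
elim: m => [|m IH]; first by rewrite /splitting big_ord0 mulr1.
by rewrite addSn !splittingS IH inZpD inZpN addr0 mulrAC.
Qed.

Lemma splitting_mod a m :
  splitting a m = splitting a (m %% n.+1)%N * monodromy w a ^+ (m %/ n.+1)%N.
Proof.
rewrite {1}(divn_eq m n.+1); elim: (m %/ n.+1)%N => [|k IH].
  by rewrite mul0n add0n expr0 mulr1.
by rewrite mulSn -addnA addnC splittingDN IH exprSr mulrA.
Qed.

Lemma monodromy_neq0 a : monodromy w a != 0.
Proof. by apply/prodf_neq0 => j _; case: cw => w0 _; apply: w0. Qed.

(** As [w] is periodic in [c], [splittingP] at [c = 0] and at [c = n.+1] have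
    the same [w]-factor; comparing them leaves the three monodromies. *)
Lemma monodromyD a b : monodromy w (a + b) = monodromy w a * monodromy w b.
Proof.
have sN c : splitting c n.+1 = splitting c 0 * monodromy w c.
  by rewrite -splittingDN.
have := splittingP a b n.+1; have := splittingP a b 0.
rewrite addn0 splittingDN !sN inZpN inZp0 valZpK.
set x := splitting (a + b) 0; set y := splitting a b; set t := splitting b 0.
move=> E; have x0 : t * y != 0 by rewrite mulf_neq0 ?splitting_neq0.
rewrite [x * _ * y]mulrAC [w a b 0 * _]mulrA E => H.
by apply: (mulfI x0); rewrite H; ring.
Qed.

Lemma monodromy_inZp (m : nat) :
  monodromy w (inZp m) = monodromy w Zp1 ^+ m.
Proof.
elim: m => [|m IH]; last by rewrite inZpS monodromyD IH exprSr.
rewrite inZp0 expr0; apply: (mulfI (monodromy_neq0 0)).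
by rewrite -monodromyD addr0 mulr1.
Qed.

Lemma monodromy_unity : monodromy w Zp1 ^+ n.+1 = 1.
Proof. by rewrite -monodromy_inZp inZpN -inZp0 monodromy_inZp expr0. Qed.

(** Restricting [splitting] to representatives replaces [splitting a (b + c)] by
    its value at the residue of [b + c]; the error is [monodromy w a] to the
    power of the carry, which is the standard cocycle because the monodromy is a
    homomorphism in [a]. *)
Theorem cocycle_std : exists be,
  (forall a b, be a b != 0) /\
  forall a b c, w a b c = std3 (monodromy w Zp1) a b c * cobound be a b c.
Proof.
exists (fun a b => splitting a b); split=> [a b|a b c].
  exact: splitting_neq0.
have := splittingP a b c; rewrite !valZpK [splitting a (b + c)]splitting_mod => E.
rewrite /cobound /std3 exprM -monodromy_inZp valZpK.
have s0 : splitting (a + b) c * splitting a b != 0.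
  by rewrite mulf_neq0 ?splitting_neq0.
by apply: (mulIf s0); rewrite E -[RHS]mulrA divfK //=; ring.
Qed.

End Splitting.

(** The product telescopes around the cycle. *)
Lemma monodromy_cobound be : (forall a b, be a b != 0) ->
  monodromy (cobound be) Zp1 = 1.
Proof.
move=> be0.
pose u (j : nat) := be Zp1 (inZp j) / be (inZp j) Zp1.
have u0 j : u j != 0 by rewrite mulf_neq0 ?invr_eq0 ?be0.
rewrite /monodromy (eq_bigr (fun j : 'I_n.+1 => u j.+1 / u j)) => [|j _]; last first.
  rewrite /cobound /u inZpS [Zp1 + _]addrC !invfM invrK.
  by ring.
rewrite -(big_mkord xpredT (fun j => u j.+1 / u j)) telescope_prodf //.
by rewrite {1}/u inZpN -inZp0 -/(u 0%N) divff ?u0.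
Qed.

Lemma carryD (x d : nat) :
  ((x %% n.+1 + d) %/ n.+1 + x %/ n.+1 = (x + d) %/ n.+1)%N.
Proof. by rewrite [in RHS](divn_eq x n.+1) -addnA divnMDl // addnC. Qed.

Lemma std3_cocycle (z : K) : z ^+ n.+1 = 1 -> is_cocycle (std3 z).
Proof.
move=> zN; have z0 : z != 0.
  by apply/eqP => z0; move/eqP: zN; rewrite z0 expr0n /= eq_sym oner_eq0.
split=> [a b c|a b c d]; first by rewrite expf_neq0.
rewrite /std3 /= [in RHS]exprM expr_mod // -exprM -!exprD; congr (_ ^+ _).
have E := carryD (c + d) b.
rewrite [(c + d + b)%N]addnC addnA -(carryD (b + c)) [((c + d) %% _ + b)%N]addnC in E.
by rewrite mulnDl -[LHS]addnA -mulnDr -E mulnDr; ring.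
Qed.

Lemma additive_inZp (phi : G -> G) (m : nat) :
  {morph phi : a b / a + b} -> phi (inZp m) = inZp (phi Zp1 * m).
Proof.
move=> phiD; have phi0 : phi 0 = 0.
  by apply: (addrI (phi 0)); rewrite -phiD !addr0.
elim: m => [|m IH]; first by rewrite inZp0 muln0 inZp0.
by rewrite inZpS phiD IH mulnS addnC inZpD valZpK.
Qed.

Definition pull3 (phi : G -> G) w a b c : K := w (phi a) (phi b) (phi c).

(** Adding [p] to itself [n.+1] times produces [p] carries in total. *)
Lemma monodromy_pull_std3 (phi : G -> G) (z : K) :
  {morph phi : a b / a + b} ->
  monodromy (pull3 phi (std3 z)) Zp1 = z ^+ (phi Zp1 * phi Zp1).
Proof.
move=> phiD; rewrite /monodromy /pull3 /std3; set p := phi Zp1.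
suff H m : \prod_(j < m) z ^+ (p * ((phi (inZp j) + p) %/ n.+1))
         = z ^+ (p * (p * m %/ n.+1)) :> K by rewrite H mulnK.
elim: m => [|m IH]; first by rewrite big_ord0 muln0 div0n muln0.
rewrite big_ord_recr /= IH additive_inZp // -/p -exprD -mulnDr /= addnC carryD.
by rewrite mulnS addnC.
Qed.

Lemma monodromy_std3 (z : K) : z ^+ n.+1 = 1 -> monodromy (std3 z) Zp1 = z.
Proof.
move=> zN; rewrite -[LHS]/(monodromy (pull3 id (std3 z)) Zp1).
rewrite monodromy_pull_std3 //= -(expr_mod _ zN) modnMml modnMmr mul1n.
by rewrite expr_mod.
Qed.

End Cohomology.

(** * Linear categories and Schur's lemma *)

Section LinearCategories.
Variables (K : fieldType) (C : linCat K).
Implicit Types X Y Z W : C.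

Lemma compmDl X Y Z (g g' : mor Y Z) (f : mor X Y) :
  (g + g') \oc f = g \oc f + g' \oc f.
Proof. by have := compm_linl 1 g g' f; rewrite !scale1r. Qed.

Lemma compmDr X Y Z (g : mor Y Z) (f f' : mor X Y) :
  g \oc (f + f') = g \oc f + g \oc f'.
Proof. by have := compm_linr 1 g f f'; rewrite !scale1r. Qed.

Lemma comp0m X Y Z (f : mor X Y) : (0 : mor Y Z) \oc f = 0.
Proof. by apply: (addrI (0 \oc f)); rewrite -compmDl !addr0. Qed.

Lemma compm0 X Y Z (g : mor Y Z) : g \oc (0 : mor X Y) = 0.
Proof. by apply: (addrI (g \oc 0)); rewrite -compmDr !addr0. Qed.

Lemma compmZl X Y Z s (g : mor Y Z) (f : mor X Y) :
  (s *: g) \oc f = s *: (g \oc f).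
Proof. by have := compm_linl s g 0 f; rewrite !(addr0, comp0m). Qed.

Lemma compmZr X Y Z s (g : mor Y Z) (f : mor X Y) :
  g \oc (s *: f) = s *: (g \oc f).
Proof. by have := compm_linr s g f 0; rewrite !(addr0, compm0). Qed.

Lemma compmBl X Y Z (g g' : mor Y Z) (f : mor X Y) :
  (g - g') \oc f = g \oc f - g' \oc f.
Proof. by rewrite compmDl -scaleN1r compmZl scaleN1r. Qed.

Lemma compmBr X Y Z (g : mor Y Z) (f f' : mor X Y) :
  g \oc (f - f') = g \oc f - g \oc f'.
Proof. by rewrite compmDr -scaleN1r compmZr scaleN1r. Qed.

Lemma compm_suml X Y Z (I : finType) (g : I -> mor Y Z) (f : mor X Y) :
  (\sum_i g i) \oc f = \sum_i (g i \oc f).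
Proof. exact: (big_morph (fun g => g \oc f) (fun a b => compmDl a b f) (comp0m _ f)). Qed.

Lemma compm_sumr X Y Z (I : finType) (g : mor Y Z) (f : I -> mor X Y) :
  g \oc (\sum_i f i) = \sum_i (g \oc f i).
Proof. exact: (big_morph (compm g) (compmDr g) (compm0 _ g)). Qed.

Lemma is_iso_id X : is_iso (idm X).
Proof. by exists (idm X); rewrite compm_idl. Qed.

Lemma is_iso_comp X Y Z (g : mor Y Z) (f : mor X Y) :
  is_iso g -> is_iso f -> is_iso (g \oc f).
Proof.
move=> [g' [g1 g2]] [f' [f1 f2]]; exists (f' \oc g'); split.
  by rewrite compmA -[_ \oc g]compmA g1 compm_idr f1.
by rewrite compmA -[_ \oc f']compmA f2 compm_idr g2.
Qed.

Lemma is_isoZ X Y s (f : mor X Y) : s != 0 -> is_iso f -> is_iso (s *: f).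
Proof.
move=> s0 [g [g1 g2]]; exists (s^-1 *: g).
by rewrite !compmZl !compmZr g1 g2 !scalerA mulVf ?divff ?scale1r.
Qed.

(** Total, so that inverses can be written without carrying a proof. *)
Definition invm X Y (f : mor X Y) : mor Y X :=
  if pselect (is_iso f) is left p then projT1 (cid p) else 0.

Lemma invmK X Y (f : mor X Y) : is_iso f -> invm f \oc f = idm X.
Proof. by rewrite /invm; case: pselect => // p _; case: cid => g []. Qed.

Lemma invmVK X Y (f : mor X Y) : is_iso f -> f \oc invm f = idm Y.
Proof. by rewrite /invm; case: pselect => // p _; case: cid => g []. Qed.

Lemma is_iso_inv X Y (f : mor X Y) : is_iso f -> is_iso (invm f).
Proof. by move=> fi; exists f; rewrite invmK ?invmVK. Qed.

Lemma iso_cancel_r X Y Z (f : mor X Y) (g h : mor Y Z) :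
  is_iso f -> g \oc f = h \oc f -> g = h.
Proof.
by move=> fi E; rewrite -[g]compm_idr -[h]compm_idr -(invmVK fi) !compmA E.
Qed.

Lemma iso_cancel_l X Y Z (f : mor Y Z) (g h : mor X Y) :
  is_iso f -> f \oc g = f \oc h -> g = h.
Proof.
by move=> fi E; rewrite -[g]compm_idl -[h]compm_idl -(invmK fi) -!compmA E.
Qed.

Lemma isomorphic_refl X : isomorphic X X.
Proof. by exists (idm X); apply: is_iso_id. Qed.

Lemma isomorphic_sym X Y : isomorphic X Y -> isomorphic Y X.
Proof. by case=> f [g [fg gf]]; exists g, f. Qed.

Lemma isomorphic_trans Y X Z :
  isomorphic X Y -> isomorphic Y Z -> isomorphic X Z.
Proof. by case=> f fi [g gi]; exists (g \oc f); apply: is_iso_comp. Qed.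

Lemma iso_mono X Y (f : mor X Y) : is_iso f -> is_mono f.
Proof. by move=> fi Z g h; apply: iso_cancel_l. Qed.

Lemma mono_comp X Y Z (g : mor Y Z) (f : mor X Y) :
  is_mono g -> is_mono f -> is_mono (g \oc f).
Proof. by move=> gm fm W h k; rewrite -!compmA => /gm /fm. Qed.

Lemma is_zero_iso X Y : isomorphic X Y -> is_zero X -> is_zero Y.
Proof.
case=> f [g [_ fg]] X0; rewrite /is_zero -fg -[f]compm_idr.
by rewrite (_ : idm X = 0) // compm0 comp0m.
Qed.

Lemma is_simple_iso X Y : isomorphic X Y -> is_simple X -> is_simple Y.
Proof.
move=> XY [X0 Xs]; split=> [Y0|Z f fm].
  by apply/X0/(is_zero_iso (isomorphic_sym XY)).
have [g gi] := isomorphic_sym XY.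
have [Z0|gfi] := Xs _ (g \oc f) (mono_comp (iso_mono gi) fm); first by left.
right; rewrite -[f]compm_idl -(invmK gi) -compmA.
by apply: is_iso_comp => //; apply: is_iso_inv.
Qed.

(** Schur's lemma: the kernel of a nonzero morphism of simple objects
    vanishes. *)
Lemma schur_iso X Y (f : mor X Y) :
  is_abelian C -> is_simple X -> is_simple Y -> f != 0 -> is_iso f.
Proof.
move=> abC [X0 Xs] [_ Ys] f0; have [Z [k [fk0 ku]]] := ab_ker abC f.
have km : is_mono k.
  move=> W g h E; have fkh : f \oc (k \oc h) = 0 by rewrite compmA fk0 comp0m.
  by have [u [_ uu]] := ku _ _ fkh; rewrite -(uu g E) -(uu h erefl).
have [Z0|ki] := Xs _ _ km; last first.
  case/eqP: f0; apply: (iso_cancel_r ki); by rewrite fk0 comp0m.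
have fm : is_mono f.
  move=> W g h E; have fgh : f \oc (g - h) = 0 by rewrite compmBr E subrr.
  have [u [uE _]] := ku _ _ fgh; apply/eqP; rewrite -subr_eq0 -uE -[u]compm_idl.
  by rewrite (_ : idm Z = 0) // comp0m compm0.
by have [] := Ys _ _ fm.
Qed.

End LinearCategories.

Section Schur.
Import VectorInternalTheory.
Variables (K : closedFieldType) (C : linCat K).
Implicit Types X Y Z : C.

(** Over an algebraically closed field, composition with an endomorphism [f] of
    [X] has an eigenvector [g], so [f - s] is not invertible for the eigenvalue
    [s] and vanishes. *)
Lemma schur_scalar X (f : mor X X) :
  is_abelian C -> is_simple X -> exists s, f = s *: idm X.
Proof.
move=> abC Xs; have [X0 _] := Xs.
have [d0|d0] := posnP (dim (mor X X)).
  case: X0; apply: (can_inj v2rK); move: (v2r _) (v2r _).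
  by rewrite d0 => u v; apply/rowP; case.
(* Left composition with [f], on coordinates of endomorphisms. *)
pose phi (v : 'rV_(dim (mor X X))) := v2r (f \oc r2v v).
have phi_lin : linear phi.
  by move=> a u v; rewrite /phi !linearP /= compm_linr linearP.
pose Phi := GRing.isLinear.Build _ _ _ _ phi phi_lin.
pose Lphi : {linear 'rV_(dim (mor X X)) -> 'rV_(dim (mor X X))} :=
  HB.pack phi Phi.
have [s] : exists s, root (char_poly (lin1_mx Lphi)) s.
  apply/closed_rootP; rewrite size_char_poly eqSS -lt0n d0 //.
rewrite -eigenvalue_root_char => /eigenvalueP[v vE v0]; exists s.
rewrite mul_rV_lin1 /= /phi in vE.
apply/eqP; rewrite -subr_eq0; apply/negPn/negP => fs.
have fi := schur_iso abC Xs Xs fs.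
case/eqP: v0; apply: (can_inj r2vK); apply: (iso_cancel_l fi).
rewrite linear0 compm0 compmBl compmZl compm_idl.
by have /(congr1 r2v) := vE; rewrite v2rK linearZ => ->; rewrite subrr.
Qed.

(** Hence all morphisms to a simple object from an isomorphic one are
    proportional. *)
Lemma schur_proportional X Y (f g : mor X Y) :
  is_abelian C -> is_simple Y -> is_iso f -> exists s, g = s *: f.
Proof.
move=> abC Ys fi; have [s E] := schur_scalar (g \oc invm f) abC Ys.
by exists s; rewrite -[g]compm_idr -(invmK fi) compmA E compmZl compm_idl.
Qed.

Lemma schur_zero X Y (f : mor X Y) :
  is_abelian C -> is_simple X -> is_simple Y -> ~ isomorphic X Y -> f = 0.
Proof.
move=> abC Xs Ys nXY; apply/eqP/negPn/negP => f0.
by apply: nXY; exists f; apply: schur_iso.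
Qed.

End Schur.

(** * Skeletal presentations and their cocycles *)

Section MonoidalCategories.
Variables (K : fieldType) (C : monCat K).
Implicit Types X Y Z W : C.

Lemma tensmDl X X' Y Y' (f f' : mor X X') (g : mor Y Y') :
  (f + f') \om g = f \om g + f' \om g.
Proof. by have := tensm_linl 1 f f' g; rewrite !scale1r. Qed.

Lemma tensmDr X X' Y Y' (f : mor X X') (g g' : mor Y Y') :
  f \om (g + g') = f \om g + f \om g'.
Proof. by have := tensm_linr 1 f g g'; rewrite !scale1r. Qed.

Lemma tens0m X X' Y Y' (g : mor Y Y') : (0 : mor X X') \om g = 0.
Proof. by apply: (addrI (0 \om g)); rewrite -tensmDl !addr0. Qed.

Lemma tensm0 X X' Y Y' (f : mor X X') : f \om (0 : mor Y Y') = 0.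
Proof. by apply: (addrI (f \om 0)); rewrite -tensmDr !addr0. Qed.

Lemma tensmZl X X' Y Y' s (f : mor X X') (g : mor Y Y') :
  (s *: f) \om g = s *: (f \om g).
Proof. by have := tensm_linl s f 0 g; rewrite !(addr0, tens0m). Qed.

Lemma tensmZr X X' Y Y' s (f : mor X X') (g : mor Y Y') :
  f \om (s *: g) = s *: (f \om g).
Proof. by have := tensm_linr s f g 0; rewrite !(addr0, tensm0). Qed.

Lemma tensm_suml X X' Y Y' (I : finType) (f : I -> mor X X') (g : mor Y Y') :
  (\sum_i f i) \om g = \sum_i (f i \om g).
Proof.
exact: (big_morph (fun f => f \om g) (fun a b => tensmDl a b g) (tens0m _ _ g)).
Qed.

Lemma tensm_sumr X X' Y Y' (I : finType) (f : mor X X') (g : I -> mor Y Y') :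
  f \om (\sum_i g i) = \sum_i (f \om g i).
Proof. exact: (big_morph (tensm f) (tensmDr f) (tensm0 _ _ f)). Qed.

Lemma tensm_idl_comp X Y Y' Y'' (g' : mor Y' Y'') (g : mor Y Y') :
  idm X \om (g' \oc g) = (idm X \om g') \oc (idm X \om g).
Proof. by rewrite -tensm_comp compm_idl. Qed.

Lemma tensm_idr_comp X Y Y' Y'' (g' : mor Y' Y'') (g : mor Y Y') :
  (g' \oc g) \om idm X = (g' \om idm X) \oc (g \om idm X).
Proof. by rewrite -tensm_comp compm_idl. Qed.

Lemma tensm_is_iso X X' Y Y' (f : mor X X') (g : mor Y Y') :
  is_iso f -> is_iso g -> is_iso (f \om g).
Proof.
move=> [f' [f1 f2]] [g' [g1 g2]]; exists (f' \om g').
by rewrite -!tensm_comp f1 f2 g1 g2 !tensm_id.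
Qed.

Lemma tens_isomorphic X X' Y Y' :
  isomorphic X X' -> isomorphic Y Y' -> isomorphic (X \ox Y) (X' \ox Y').
Proof. by case=> f fi [g gi]; exists (f \om g); apply: tensm_is_iso. Qed.

Lemma massoc_is_iso X Y Z : is_iso (massoc X Y Z).
Proof. by exists (massocV X Y Z); rewrite massocK massocVK. Qed.

End MonoidalCategories.

Section ZeroScalars.
Variables (K : fieldType) (C : linCat K).

Lemma simple_scale_inj (X Y : C) (f : mor X Y) s t :
  is_simple Y -> is_iso f -> s *: f = t *: f -> s = t.
Proof.
move=> [Y0 _] fi /eqP; rewrite -subr_eq0 -scalerBl scaler_eq0 subr_eq0.
case/orP=> [/eqP //|/eqP f0]; case: Y0; rewrite /is_zero.
by rewrite -(invmVK fi) f0 comp0m.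
Qed.

Lemma iso_neq0 (X Y : C) (f : mor X Y) : is_simple Y -> is_iso f -> f != 0.
Proof.
move=> [Y0 _] fi; apply/eqP => f0; apply: Y0.
by rewrite /is_zero -(invmVK fi) f0 comp0m.
Qed.

End ZeroScalars.

(** A skeletal presentation: representatives [X a] of the simple objects, and
    isomorphisms [mu a b (a + b)] through which the associator becomes the
    3-cochain [w]. The target of [mu] is indexed independently of [a + b], so
    that associativity needs no transport along equalities of indices. *)
Record skeleton (K : fieldType) (C : monCat K) (n : nat)
    (w : 'I_n.+1 -> 'I_n.+1 -> 'I_n.+1 -> K) (X : 'I_n.+1 -> C)
    (mu : forall a b c, mor (X a \ox X b) (X c)) : Prop := Skeleton {
  sk_simple : forall a, is_simple (X a);
  sk_inj : forall a b, isomorphic (X a) (X b) -> a = b;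
  sk_surj : forall S, is_simple S -> exists a, isomorphic S (X a);
  sk_iso : forall a b, is_iso (mu a b (a + b));
  sk_assoc : forall a b c,
    mu a (b + c) (a + (b + c)) \oc (idm (X a) \om mu b c (b + c))
      \oc massoc (X a) (X b) (X c) =
    w a b c *: (mu (a + b) c (a + (b + c)) \oc (mu a b (a + b) \om idm (X c)))
}.

Section SkeletonTheory.
Variables (K : closedFieldType) (C : fusionCat K) (n : nat).
Local Notation G := 'I_n.+1.
Implicit Types (w : G -> G -> G -> K) (X Y : G -> C).

Let abC : is_abelian C := fus_abelian (fusP C).

Lemma sk_iso_eq w X mu : @skeleton K C n w X mu ->
  forall a b c, c = a + b -> is_iso (mu a b c).
Proof. by move=> sk a b c ->; apply: (sk_iso sk). Qed.

Lemma sk_assoc_eq w X mu : @skeleton K C n w X mu ->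
  forall a b c ab bc abc, ab = a + b -> bc = b + c -> abc = a + (b + c) ->
  mu a bc abc \oc (idm (X a) \om mu b c bc) \oc massoc (X a) (X b) (X c) =
  w a b c *: (mu ab c abc \oc (mu a b ab \om idm (X c))).
Proof. by move=> sk a b c _ _ _ -> -> ->; apply: (sk_assoc sk). Qed.

Lemma sk_tens w X mu : @skeleton K C n w X mu ->
  forall a b, isomorphic (X a \ox X b) (X (a + b)).
Proof. by move=> sk a b; exists (mu a b (a + b)); apply: (sk_iso sk). Qed.

Lemma sk_neq0 w X mu a b c : @skeleton K C n w X mu -> w a b c != 0.
Proof.
move=> sk; apply/eqP => w0.
have := sk_assoc sk a b c; rewrite w0 scale0r; apply/eqP.
apply: iso_neq0; first exact: (sk_simple sk).
apply: is_iso_comp; last exact: massoc_is_iso.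
apply: is_iso_comp; first exact: (sk_iso sk).
by apply: tensm_is_iso; [apply: is_iso_id | apply: (sk_iso sk)].
Qed.

(** The pentagon, evaluated on simple objects, is the cocycle identity. *)
Lemma sk_cocycle w X mu : @skeleton K C n w X mu -> is_cocycle w.
Proof.
move=> sk; split=> [a b c|a b c d]; first exact: sk_neq0 sk.
set abcd := a + (b + (c + d)).
pose top := mu (a + b + c) d abcd
  \oc (mu (a + b) c (a + b + c) \om idm (X d))
  \oc ((mu a b (a + b) \om idm (X c)) \om idm (X d)).
have topi : is_iso top.
  apply: is_iso_comp; first apply: is_iso_comp.
  - by apply: (sk_iso_eq sk); rewrite /abcd !addrA.
  - by apply: tensm_is_iso; [apply: (sk_iso sk) | apply: is_iso_id].
  - by do 2?[apply: tensm_is_iso]; by [apply: (sk_iso sk) | apply: is_iso_id].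
apply: (simple_scale_inj (sk_simple sk _) topi).
pose bot := mu a (b + (c + d)) abcd
  \oc (idm (X a) \om mu b (c + d) (b + (c + d)))
  \oc (idm (X a) \om (idm (X b) \om mu c d (c + d))).
(* The side of the pentagon that uses the associator twice. *)
have LHS : bot \oc (massoc (X a) (X b) (X c \ox X d)
                      \oc massoc (X a \ox X b) (X c) (X d)) =
           (w (a + b) c d * w a b (c + d)) *: top.
  rewrite /bot compmA -[_ \oc massoc (X a) _ _]compmA -massoc_nat.
  rewrite compmA (sk_assoc_eq sk (ab := a + b)) //.
  rewrite !compmZl tensm_id -[_ \oc (idm _ \om mu c d _)]compmA -tensm_comp.
  rewrite compm_idl compm_idr -[X in X \om mu c d _]compm_idl.
  rewrite -[X in _ \om X]compm_idr tensm_comp compmA.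
  rewrite -[_ \oc massoc _ _ _]compmA -tensm_id -massoc_nat compmA.
  rewrite (sk_assoc_eq sk (ab := a + b + c)) //; last by rewrite /abcd !addrA.
  by rewrite !compmZl scalerA mulrC.
(* The side that uses it three times. *)
have RHS : bot \oc (massoc (X a) (X b) (X c \ox X d)
                      \oc massoc (X a \ox X b) (X c) (X d)) =
           (w b c d * w a (b + c) d * w a b c) *: top.
  rewrite mpentagon /bot !compmA.
  rewrite -[_ \oc (idm _ \om (idm _ \om _))]compmA -tensm_idl_comp.
  rewrite -[_ \oc (idm _ \om massoc _ _ _)]compmA -tensm_idl_comp.
  rewrite (sk_assoc_eq sk (ab := b + c)) // tensmZr compmZr !compmZl.
  rewrite tensm_idl_comp compmA -[_ \oc _ \oc massoc _ _ _]compmA -massoc_nat.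
  rewrite compmA (sk_assoc_eq sk (ab := a + (b + c))) ?addrA //; last first.
    by rewrite /abcd !addrA.
  rewrite !compmZl -[_ \oc _ \oc (_ \om idm _)]compmA -tensm_idr_comp.
  rewrite -[_ \oc _ \oc (_ \om idm _)]compmA -tensm_idr_comp.
  rewrite (compmA (mu a _ _)) (sk_assoc_eq sk (ab := a + b)) ?addrA //.
  rewrite tensmZl compmZr !scalerA.
  by rewrite tensm_idr_comp compmA.
by rewrite -RHS LHS.
Qed.

End SkeletonTheory.

Section SkeletonChanges.
Variables (K : closedFieldType) (C : fusionCat K) (n : nat).
Local Notation G := 'I_n.+1.
Implicit Types (w : G -> G -> G -> K) (X Y : G -> C) (be : G -> G -> K).

Let abC : is_abelian C := fus_abelian (fusP C).

Lemma sk_rescale w X mu be :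
  @skeleton K C n w X mu -> (forall a b, be a b != 0) ->
  skeleton (fun a b c => w a b c * cobound be a b c)
           (fun a b c => be a b *: mu a b c).
Proof.
move=> sk be0; split; [exact: (sk_simple sk)|exact: (sk_inj sk)|
  exact: (sk_surj sk)| |] => a b.
  by apply: is_isoZ => //; apply: (sk_iso sk).
move=> c; rewrite tensmZr tensmZl !(compmZl, compmZr) !scalerA (sk_assoc sk) scalerA.
congr (_ *: _); rewrite /cobound; field; by rewrite !be0.
Qed.

Lemma sk_std w X mu : @skeleton K C n w X mu ->
  exists mu', @skeleton K C n (std3 (monodromy w Zp1)) X mu'.
Proof.
move=> sk; have [be [be0 E]] := cocycle_std (sk_cocycle sk).
have be0' a b : (be a b)^-1 != 0 by rewrite invr_eq0.
exists (fun a b c => (be a b)^-1 *: mu a b c).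
suff -> : std3 (monodromy w Zp1) =
    (fun a b c => w a b c * cobound (fun a b => (be a b)^-1) a b c).
  exact: sk_rescale.
apply/funext => a; apply/funext => b; apply/funext => c.
by rewrite E /cobound; field; rewrite !be0 oner_neq0.
Qed.

(** Two choices of [mu] on the same objects differ by scalars, by Schur's
    lemma, so their cocycles are cohomologous. *)
Lemma sk_monodromy_eq w w' X mu mu' :
  @skeleton K C n w X mu -> @skeleton K C n w' X mu' ->
  monodromy w Zp1 = monodromy w' Zp1.
Proof.
move=> sk sk'.
have be_ex a b : exists s, mu' a b (a + b) = s *: mu a b (a + b).
  by apply: schur_proportional => //; [apply: (sk_simple sk) | apply: (sk_iso sk)].
pose be a b := projT1 (cid (be_ex a b)).
have beE a b c : c = a + b -> mu' a b c = be a b *: mu a b c.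
  by move=> ->; rewrite /be; case: cid.
have be0 a b : be a b != 0.
  apply/eqP => b0; have := iso_neq0 (sk_simple sk' (a + b)) (sk_iso sk' a b).
  by rewrite beE // b0 scale0r eqxx.
suff E a b c : w' a b c = w a b c * cobound be a b c.
  have -> : monodromy w' Zp1 = monodromy w Zp1 * monodromy (cobound be) Zp1.
    by rewrite -big_split; apply: eq_bigr => j _; rewrite E.
  by rewrite monodromy_cobound // mulr1.
have skb := sk_rescale sk be0; have := sk_assoc skb a b c.
rewrite -!beE ?addrA // -addrA (sk_assoc sk').
apply: simple_scale_inj; first exact: (sk_simple sk).
apply: is_iso_comp; first by apply: (sk_iso_eq sk'); rewrite addrA.
by apply: tensm_is_iso; [apply: (sk_iso sk') | apply: is_iso_id].
Qed.

(** Conjugating [mu] by isomorphisms of the representatives leaves the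
    associator scalars unchanged. *)
Lemma sk_change_objects w X Y mu : @skeleton K C n w X mu ->
  (forall a, isomorphic (Y a) (X a)) -> exists nu, @skeleton K C n w Y nu.
Proof.
move=> sk YX; pose s a := projT1 (cid (YX a)).
have si a : is_iso (s a) by rewrite /s; case: cid.
exists (fun a b c => invm (s c) \oc mu a b c \oc (s a \om s b)).
split=> [a|a b YY|S Ss|a b|a b c].
- by apply: (is_simple_iso (isomorphic_sym (YX a))); apply: (sk_simple sk).
- apply: (sk_inj sk); apply: (isomorphic_trans _ (YX b)).
  by apply: (isomorphic_trans _ YY); apply: isomorphic_sym.
- have [a Sa] := sk_surj sk Ss; exists a.
  by apply: (isomorphic_trans Sa); apply: isomorphic_sym.
- apply: is_iso_comp; last exact: tensm_is_iso.
  by apply: is_iso_comp; [apply: is_iso_inv|apply: (sk_iso sk)].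
have cancel_s a' b' c' (f : mor (X b') (X c')) (g : mor (X a') (X b')) :
    f \oc s b' \oc (invm (s b') \oc g) = f \oc g.
  by rewrite compmA -[_ \oc invm _]compmA invmVK // compm_idr.
pose T := (s a \om s b) \om s c.
transitivity (invm (s (a + (b + c))) \oc (mu a (b + c) (a + (b + c))
    \oc (idm (X a) \om mu b c (b + c)) \oc massoc (X a) (X b) (X c)) \oc T).
  rewrite /T !compmA -[in RHS]compmA massoc_nat !compmA; congr (_ \oc _).
  rewrite -!compmA; congr (_ \oc (_ \oc _)); rewrite -!tensm_comp.
  by rewrite compm_idr compm_idl !compmA invmVK // compm_idl.
rewrite (sk_assoc sk) compmZr compmZl; congr (_ *: _).
rewrite /T !compmA -!compmA; congr (_ \oc (_ \oc _)); rewrite -!tensm_comp.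
by rewrite compm_idr compm_idl !compmA invmVK // compm_idl.
Qed.

Lemma sk_reindex w X mu (phi : G -> G) : @skeleton K C n w X mu ->
  {morph phi : a b / a + b} -> injective phi ->
  @skeleton K C n (pull3 phi w) (X \o phi)
    (fun a b c => mu (phi a) (phi b) (phi c)).
Proof.
move=> sk phiD phi_inj; split=> [a|a b /(sk_inj sk)/phi_inj //|S|a b|a b c].
- exact: (sk_simple sk).
- move=> /(sk_surj sk)[a Sa]; have [psi _ psiK] := injF_bij phi_inj.
  by exists (psi a); rewrite /= psiK.
- by apply: (sk_iso_eq sk); apply: phiD.
- by apply: (sk_assoc_eq sk); rewrite !phiD.
Qed.

(** The representatives of two skeletal presentations correspond through an
    automorphism [phi] of the group; it multiplies by [p = phi 1], and pulling
    back along it raises the monodromy to the power [p ^ 2]. *)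
Lemma sk_std_unique z z' X Y mu nu : z' ^+ n.+1 = 1 ->
  @skeleton K C n (std3 z) X mu -> @skeleton K C n (std3 z') Y nu ->
  exists p q : G, Zp_mul p q = Zp1 /\ z' = z ^+ (p * p).
Proof.
move=> z'N sk sk'.
have YX a : exists b, isomorphic (Y a) (X b) by apply/(sk_surj sk)/(sk_simple sk').
pose phi a := projT1 (cid (YX a)).
have phiP a : isomorphic (Y a) (X (phi a)) by rewrite /phi; case: cid.
have phi_inj : injective phi.
  move=> a b E; apply: (sk_inj sk'); apply: (isomorphic_trans (phiP a)).
  by rewrite E; apply/isomorphic_sym.
have phiD : {morph phi : a b / a + b}.
  move=> a b; apply: (sk_inj sk).
  apply: isomorphic_trans (isomorphic_sym (phiP _)) _.
  apply: isomorphic_trans (isomorphic_sym (sk_tens sk' _ _)) _.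
  apply: isomorphic_trans _ (sk_tens sk _ _).
  by apply: tens_isomorphic.
have [psi _ psiK] := injF_bij phi_inj.
exists (phi Zp1), (psi Zp1); split.
  by rewrite -[RHS]psiK -[in RHS](valZpK (psi Zp1)) additive_inZp //; apply/val_inj.
have [nu' sk''] := sk_change_objects (sk_reindex sk phiD phi_inj) phiP.
by have := sk_monodromy_eq sk' sk''; rewrite monodromy_std3 // monodromy_pull_std3.
Qed.

Definition has_type z : Prop :=
  z ^+ n.+1 = 1 /\ exists X mu, @skeleton K C n (std3 z) X mu.

Lemma sk_has_type w X mu : @skeleton K C n w X mu ->
  has_type (monodromy w Zp1).
Proof.
move=> sk; split; first exact/monodromy_unity/(sk_cocycle sk).
by exists X; apply: sk_std sk.
Qed.

Lemma has_type_unique z z' : has_type z -> has_type z' ->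
  exists p q : G, Zp_mul p q = Zp1 /\ z' = z ^+ (p * p).
Proof. by move=> [_ [X [mu sk]]] [z'N [Y [nu sk']]]; apply: sk_std_unique sk sk'. Qed.

Lemma has_type_square z (p q : G) : Zp_mul p q = Zp1 -> has_type z ->
  has_type (z ^+ (p * p)).
Proof.
move=> pq [zN [X [mu sk]]]; pose phi a := Zp_mul p a.
have phiD : {morph phi : a b / a + b} by move=> a b; apply: Zp_mul_addr.
have phi_inj : injective phi.
  apply: (can_inj (g := Zp_mul q)) => a; rewrite /phi Zp_mulA [Zp_mul q p]Zp_mulC pq.
  exact: Zp_mul1z.
have := sk_has_type (sk_reindex sk phiD phi_inj).
by rewrite monodromy_pull_std3 // /phi Zp_mulz1.
Qed.

End SkeletonChanges.

(** * Fusion rules and invariance under equivalence *)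

Section Rules.
Variables (K : closedFieldType) (C : fusionCat K) (n : nat).
Local Notation G := 'I_n.+1.

Let abC : is_abelian C := fus_abelian (fusP C).

Lemma rules_has_type : @has_VecZN_rules K n.+1 C -> exists z, @has_type K C n z.
Proof.
move=> [_ [deg [degP deg_surj deg_tens]]].
have Xex (a : G) : exists X : C, is_simple X /\ deg X = a.
  by have [X Xs Xa] := deg_surj a; exists X.
pose X a := projT1 (cid (Xex a)).
have Xs a : is_simple (X a) by rewrite /X; case: cid => ? [].
have Xd a : deg (X a) = a by rewrite /X; case: cid => ? [].
have tXs a b : is_simple (X a \ox X b) by have [] := deg_tens _ _ (Xs a) (Xs b).
have muex a b c : exists m : mor (X a \ox X b) (X c), c = a + b -> is_iso m.
  case: (pselect (c = a + b)) => [->|ne]; last by exists 0.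
  suff [m mi] : isomorphic (X a \ox X b) (X (a + b)) by exists m.
  by apply/degP => //; have [_ ->] := deg_tens _ _ (Xs a) (Xs b); rewrite !Xd.
pose mu a b c := projT1 (cid (muex a b c)).
have mui a b c : c = a + b -> is_iso (mu a b c) by rewrite /mu; case: cid.
have wex a b c : exists s, mu a (b + c) (a + (b + c))
    \oc (idm (X a) \om mu b c (b + c)) \oc massoc (X a) (X b) (X c) =
    s *: (mu (a + b) c (a + (b + c)) \oc (mu a b (a + b) \om idm (X c))).
  apply: schur_proportional => //; apply: is_iso_comp; first by apply: mui; rewrite addrA.
  by apply: tensm_is_iso; [apply: mui | apply: is_iso_id].
pose w a b c := projT1 (cid (wex a b c)).
have sk : skeleton w mu.
  split=> // [a b /degP|S Ss|a b|a b c].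
  - by rewrite !Xd; apply.
  - by exists (deg S); apply/degP; rewrite ?Xd.
  - exact: mui.
  - by rewrite /w; case: cid.
by exists (monodromy w Zp1); apply: sk_has_type sk.
Qed.

(** The unit is simple, hence some [X e], and [e + e = e]. *)
Lemma sk_unit w X mu : @skeleton K C n w X mu -> isomorphic munit (X 0).
Proof.
move=> sk; have [e ue] := sk_surj sk (fus_unit (fusP C)).
suff e0 : e = 0 by rewrite -e0.
apply: (addrI e); rewrite addr0; apply/esym/(sk_inj sk).
apply: isomorphic_trans (isomorphic_sym ue) _.
apply: isomorphic_trans _ (sk_tens sk _ _).
apply: (isomorphic_trans (Y := munit \ox munit)); last exact: tens_isomorphic.
by apply: isomorphic_sym; exists (mlunit munit); apply: mlunit_iso.
Qed.

Lemma has_type_rules z : @has_type K C n z -> @has_VecZN_rules K n.+1 C.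
Proof.
move=> [_ [X [mu sk]]]; have uX := sk_unit sk.
have Xinv a b : a + b = 0 -> isomorphic (X a \ox X b) munit.
  move=> ab; apply: isomorphic_trans (sk_tens sk a b) _.
  by rewrite ab; apply: isomorphic_sym.
split=> [S Ss|].
  have [a Sa] := sk_surj sk Ss; exists (X (- a)); split.
    apply: isomorphic_trans _ (Xinv a (- a) (subrr a)).
    exact/tens_isomorphic/isomorphic_refl.
  apply: isomorphic_trans _ (Xinv (- a) a (addNr a)).
  by apply: tens_isomorphic => //; apply: isomorphic_refl.
pose deg (S : C) : G :=
  if pselect (exists a, isomorphic S (X a)) is left p then projT1 (cid p) else 0.
have degP S : is_simple S -> isomorphic S (X (deg S)).
  move=> /(sk_surj sk); rewrite /deg; case: pselect => // p _; by case: cid.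
have degE S a : is_simple S -> isomorphic S (X a) -> deg S = a.
  move=> Ss Sa; apply: (sk_inj sk); apply: isomorphic_trans _ Sa.
  exact/isomorphic_sym/degP.
exists deg; split=> [S T Ss Ts|a|S T Ss Ts].
- split=> [ST|E]; first by apply: degE => //; apply: isomorphic_trans ST (degP _ Ts).
  by apply: isomorphic_trans (degP _ Ss) _; rewrite E; apply/isomorphic_sym/degP.
- exists (X a); first exact: (sk_simple sk).
  by apply: degE; [apply: (sk_simple sk) | apply: isomorphic_refl].
have ST : isomorphic (S \ox T) (X (deg S + deg T)).
  apply: isomorphic_trans _ (sk_tens sk _ _).
  by apply: tens_isomorphic; apply: degP.
have STs : is_simple (S \ox T).
  by apply: is_simple_iso (isomorphic_sym ST) _; apply: (sk_simple sk).
by split=> //; apply: degE.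
Qed.

(** In a semisimple category an object whose endomorphisms are the scalars has
    a single simple summand. *)
Lemma simple_of_scalar_end (X : C) : ~ is_zero X ->
  (forall f : mor X X, exists s, f = s *: idm X) -> is_simple X.
Proof.
move=> X0 sc; have [m [S [Ss [i [p [pi _ ip]]]]]] := fus_semisimple (fusP C) X.
have [k k0] : exists k, i k \oc p k <> 0.
  apply: contrapT => nk; apply: X0; rewrite /is_zero -ip big1 // => k _.
  by apply: contrapT => ?; apply: nk; exists k.
apply: (is_simple_iso _ (Ss k)); exists (i k), (p k); split; first exact: pi.
have [s E] := sc (i k \oc p k).
have : i k \oc p k \oc (i k \oc p k) = i k \oc p k.
  by rewrite compmA -[_ \oc i k]compmA pi compm_idr.
rewrite {1 2}E compmZl compmZr compm_idl scalerA E => /eqP.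
rewrite -subr_eq0 -scalerBl -[X in s * s - X]mulr1 -mulrBr scaler_eq0 mulf_eq0.
have sX0 : s *: idm X != 0 by rewrite -E; apply/eqP.
case/orP => [/orP[/eqP s0|]|/eqP X0'].
- by move: sX0; rewrite s0 scale0r eqxx.
- by rewrite subr_eq0 => /eqP ->; rewrite scale1r.
- by move: sX0; rewrite X0' scaler0 eqxx.
Qed.

End Rules.

Section Functors.
Variables (K : fieldType) (C D : linCat K) (F : linFunctor C D).
Implicit Types X Y Z : C.

Lemma fmapD X Y (f g : mor X Y) : fmap F (f + g) = fmap F f + fmap F g.
Proof. by have := fmap_lin F 1 f g; rewrite !scale1r. Qed.

Lemma fmap0 X Y : fmap F (0 : mor X Y) = 0.
Proof. by apply: (addrI (fmap F 0)); rewrite -fmapD !addr0. Qed.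

Lemma fmapZ X Y s (f : mor X Y) : fmap F (s *: f) = s *: fmap F f.
Proof. by have := fmap_lin F s f 0; rewrite !addr0 fmap0 addr0. Qed.

Lemma fmap_sum X Y (I : finType) (f : I -> mor X Y) :
  fmap F (\sum_i f i) = \sum_i fmap F (f i).
Proof. exact: (big_morph (@fmap _ _ _ F X Y) (@fmapD X Y) (fmap0 X Y)). Qed.

Lemma fmap_iso X Y (f : mor X Y) : is_iso f -> is_iso (fmap F f).
Proof.
by move=> [g [gf fg]]; exists (fmap F g); rewrite -!fmap_comp gf fg !fmap_id.
Qed.

Lemma fmap_isomorphic X Y : isomorphic X Y -> isomorphic (F X) (F Y).
Proof. by case=> f fi; exists (fmap F f); apply: fmap_iso. Qed.

Definition fully_faithful : Prop :=
  (forall X Y (f g : mor X Y), fmap F f = fmap F g -> f = g) /\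
  (forall X Y (g : mor (F X) (F Y)), exists f, fmap F f = g).

Definition essentially_surjective : Prop :=
  forall Y : D, exists X, isomorphic (F X) Y.

End Functors.

Section Equivalences.
Variables (K : fieldType) (C D : linCat K) (F : linFunctor C D).

Lemma equivalence_ff : is_equivalence F ->
  fully_faithful F /\ essentially_surjective F.
Proof.
move=> [G' [eta [eps [etai epsi eta_nat eps_nat]]]].
have F_inj (X Y : C) (f g : mor X Y) : fmap F f = fmap F g -> f = g.
  by move=> E; apply: (iso_cancel_l (etai _)); rewrite !eta_nat E.
have G_inj (X Y : D) (f g : mor X Y) : fmap G' f = fmap G' g -> f = g.
  by move=> E; apply: (iso_cancel_r (epsi _)); rewrite -!eps_nat E.
split; last by move=> Y; exists (G' Y), (eps Y).
split=> // X Y g; exists (invm (eta Y) \oc fmap G' g \oc eta X).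
apply: G_inj; apply: (iso_cancel_r (etai _)); rewrite -eta_nat.
by rewrite !compmA invmVK // compm_idl.
Qed.

Lemma ff_equivalence : fully_faithful F -> essentially_surjective F ->
  is_equivalence F.
Proof.
move=> [F_inj F_full] F_surj.
pose Go Y := projT1 (cid (F_surj Y)).
have epsex Y : exists e : mor (F (Go Y)) Y, is_iso e by rewrite /Go; case: cid.
pose eps Y := projT1 (cid (epsex Y)).
have epsi Y : is_iso (eps Y) by rewrite /eps; case: cid.
pose lift X Y g := projT1 (cid (F_full X Y g)).
have liftK X Y g : fmap F (lift X Y g) = g by rewrite /lift; case: cid.
pose Gm Y Y' (g : mor Y Y') := lift _ _ (invm (eps Y') \oc g \oc eps Y).
have Glin X Y a (f g : mor X Y) : Gm _ _ (a *: f + g) = a *: Gm _ _ f + Gm _ _ g.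
  by apply: F_inj; rewrite fmap_lin !liftK compm_linr compm_linl.
have Gid Y : Gm _ _ (idm Y) = idm (Go Y).
  by apply: F_inj; rewrite liftK fmap_id compm_idr invmK.
have Gcomp X Y Z (g : mor Y Z) (f : mor X Y) : Gm _ _ (g \oc f) = Gm _ _ g \oc Gm _ _ f.
  apply: F_inj; rewrite fmap_comp !liftK !compmA.
  by rewrite -[_ \oc eps Y \oc _]compmA invmVK // compm_idr.
pose G' := LinFunctor Glin Gid Gcomp.
pose eta X : mor X (G' (F X)) := lift _ _ (invm (eps (F X))).
exists G', eta, eps; split=> [X|//|X X' f|Y Y' g].
- exists (lift _ _ (eps (F X))); split; apply: F_inj.
    by rewrite fmap_comp !liftK fmap_id invmVK.
  by rewrite fmap_comp !liftK fmap_id invmK.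
- apply: F_inj; rewrite !fmap_comp /= !liftK -[_ \oc eps _ \oc _]compmA.
  by rewrite invmVK // compm_idr.
- by rewrite /= liftK !compmA invmVK // compm_idl.
Qed.

End Equivalences.

Section Transport.
Variables (K : closedFieldType) (C D : fusionCat K) (n : nat).

(** A fully faithful functor preserves endomorphism algebras, which detect
    simplicity by Schur's lemma and its converse [simple_of_scalar_end]. *)
Lemma ff_simple (F : linFunctor C D) (X : C) : fully_faithful F ->
  is_simple X <-> is_simple (F X).
Proof.
move=> [F_inj F_full]; split=> Xs; apply: simple_of_scalar_end.
- move=> F0; have [X0 _] := Xs; apply: X0; apply: F_inj.
  by rewrite fmap_id fmap0.
- move=> g; have [f <-] := F_full _ _ g.
  have [s ->] := schur_scalar f (fus_abelian (fusP C)) Xs.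
  by exists s; rewrite fmapZ fmap_id.
- move=> X0; have [F0 _] := Xs; apply: F0.
  by rewrite /is_zero -fmap_id (_ : idm X = 0) ?fmap0.
- move=> f; have [s E] := schur_scalar (fmap F f) (fus_abelian (fusP D)) Xs.
  by exists s; apply: F_inj; rewrite fmapZ fmap_id.
Qed.

(** The image of a skeletal presentation under a monoidal equivalence, with [mu]
    composed with the tensor constraint, has the same cocycle. *)
Lemma has_type_transport z :
  mon_equivalent C D -> @has_type K C n z -> @has_type K D n z.
Proof.
move=> [F /equivalence_ff[Fff Fsurj]] [zN [X [mu sk]]].
have [F_inj F_full] := Fff.
split=> //; exists (fun a => F (X a)).
exists (fun a b c => fmap F (mu a b c) \oc mf_tens F (X a) (X b)).
split=> [a|a b|S Ss|a b|a b c].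
- by apply/ff_simple => //; apply: (sk_simple sk).
- move=> [g [h [hg gh]]]; apply: (sk_inj sk).
  have [f fE] := F_full _ _ g; have [k kE] := F_full _ _ h.
  by exists f, k; split; apply: F_inj; rewrite fmap_comp fmap_id kE fE.
- have [T FT] := Fsurj S.
  have Ts : is_simple T.
    by apply/(ff_simple _ Fff)/(is_simple_iso (isomorphic_sym FT)).
  have [a Ta] := sk_surj sk Ts; exists a.
  apply: isomorphic_trans (isomorphic_sym FT) _; exact: fmap_isomorphic.
- apply: is_iso_comp; last exact: mf_tens_iso.
  by apply: fmap_iso; apply: (sk_iso sk).
rewrite tensm_idl_comp tensm_idr_comp !compmA.
rewrite -[_ \oc (idm _ \om fmap F _)]compmA -[idm (F (X a))]fmap_id mf_tens_nat.
rewrite fmap_id !compmA -[_ \oc (idm _ \om mf_tens F _ _)]compmA.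
rewrite -[_ \oc _ \oc massoc _ _ _]compmA -mf_assoc !compmA -!fmap_comp.
rewrite (sk_assoc sk) fmapZ !compmZl; congr (_ *: _).
rewrite fmap_comp -[_ \oc (fmap F _ \om idm _)]compmA -[idm (F (X c))]fmap_id.
by rewrite mf_tens_nat !compmA.
Qed.

End Transport.

(** * Decompositions into simple objects *)

Record decomp (K : fieldType) (C : linCat K) (n : nat) (X : 'I_n.+1 -> C)
    (m : nat) (d : 'I_m -> 'I_n.+1) (S : C) := Decomp {
  dinj : forall k, mor (X (d k)) S;
  dproj : forall k, mor S (X (d k));
  dprojK : forall k, dproj k \oc dinj k = idm (X (d k));
  dproj0 : forall k l, k != l -> dproj l \oc dinj k = 0;
  dsum : \sum_k (dinj k \oc dproj k) = idm S
}.

Section Decompositions.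
Variables (K : fieldType) (C : linCat K) (n : nat) (X : 'I_n.+1 -> C).

Lemma direct_sum_decomp m (d : 'I_m -> 'I_n.+1) (T : 'I_m -> C) S :
  (forall k, isomorphic (T k) (X (d k))) -> is_direct_sum T S ->
  exists _ : decomp X d S, True.
Proof.
move=> TX [i [p [pi pi0 ip]]]; pose s k := projT1 (cid (TX k)).
have si k : is_iso (s k) by rewrite /s; case: cid.
have cK k l (f : mor (T l) S) (g : mor S (T k)) :
    s k \oc g \oc (f \oc invm (s l)) = s k \oc (g \oc f) \oc invm (s l).
  by rewrite !compmA.
unshelve eexists => //.
apply: (@Decomp K C n X m d S (fun k => i k \oc invm (s k)) (fun k => s k \oc p k)).
- by move=> k; rewrite cK pi compm_idr invmVK.
- by move=> k l kl; rewrite cK pi0 // compm0 comp0m.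
- rewrite -ip; apply: eq_bigr => k _.
  by rewrite compmA -[_ \oc s k]compmA invmK // compm_idr.
Qed.

Lemma decomp_self a : exists _ : decomp X (fun _ : 'I_1 => a) (X a), True.
Proof.
apply: (direct_sum_decomp (T := fun=> X a)) => [k|]; first exact: isomorphic_refl.
exists (fun=> idm _), (fun=> idm _); split=> [k|k l|].
- by rewrite compm_idl.
- by rewrite !ord1.
- by rewrite big_ord1 compm_idl.
Qed.

Variables (m : nat) (d : 'I_m -> 'I_n.+1) (S : C) (dS : decomp X d S).
Variables (m' : nat) (d' : 'I_m' -> 'I_n.+1) (S' : C) (dS' : decomp X d' S').

Definition of_entries (M : forall l k, mor (X (d k)) (X (d' l))) : mor S S' :=
  \sum_l \sum_k (dinj dS' l \oc M l k \oc dproj dS k).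

Lemma of_entriesE M l k : dproj dS' l \oc of_entries M \oc dinj dS k = M l k.
Proof.
rewrite /of_entries compm_sumr compm_suml (bigD1 l) //= [X in _ + X]big1 ?addr0; last first.
  move=> l' ll'; rewrite compm_sumr compm_suml big1 // => k' _.
  by rewrite !compmA dproj0 // !comp0m.
rewrite compm_sumr compm_suml (bigD1 k) //= [X in _ + X]big1 ?addr0; last first.
  by move=> k' kk'; rewrite -!compmA dproj0 ?compm0 // eq_sym.
by rewrite !compmA dprojK compm_idl -compmA dprojK compm_idr.
Qed.

Lemma entries_inj (f g : mor S S') :
  (forall l k, dproj dS' l \oc f \oc dinj dS k = dproj dS' l \oc g \oc dinj dS k) ->
  f = g.
Proof.
move=> E; rewrite -[f]compm_idl -[g]compm_idl -(dsum dS') !compm_suml.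
apply: eq_bigr => l _; rewrite -[dinj _ _ \oc _ \oc f]compm_idr.
rewrite -[dinj _ _ \oc _ \oc g]compm_idr -(dsum dS) !compm_sumr.
apply: eq_bigr => k _; rewrite !compmA; congr (_ \oc _).
by rewrite -!compmA; congr (_ \oc _); rewrite !compmA.
Qed.

End Decompositions.

(** A family of morphisms that is jointly split epic, so that equalities of
    morphisms out of [A] can be tested on it. *)
Definition covers (K : fieldType) (C : linCat K) (I : finType) (Y : I -> C)
    (A : C) (e : forall i, mor (Y i) A) : Prop :=
  exists r : forall i, mor A (Y i), \sum_i (e i \oc r i) = idm A.

Section Covers.
Variables (K : fieldType) (C : monCat K).

Lemma covers_test (I : finType) (Y : I -> C) A (e : forall i, mor (Y i) A)
    B (f g : mor A B) :
  covers e -> (forall i, f \oc e i = g \oc e i) -> f = g.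
Proof.
move=> [r re] E; rewrite -[f]compm_idr -[g]compm_idr -re !compm_sumr.
by apply: eq_bigr => i _; rewrite !compmA E.
Qed.

Lemma covers_id (A : C) : covers (fun _ : unit => idm A).
Proof. by exists (fun=> idm A); rewrite (big_pred1 tt) ?compm_idl // => -[]. Qed.

Lemma covers_tens (I J : finType) (Y : I -> C) (Z : J -> C) A B
    (e : forall i, mor (Y i) A) (f : forall j, mor (Z j) B) :
  covers e -> covers f -> covers (fun ij : I * J => e ij.1 \om f ij.2).
Proof.
move=> [r er] [s fs]; exists (fun ij => r ij.1 \om s ij.2).
rewrite -tensm_id -er -fs tensm_suml.
under [RHS]eq_bigr do rewrite tensm_sumr.
by rewrite pair_bigA; apply: eq_bigr => -[i j] _; rewrite tensm_comp.
Qed.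

End Covers.

Section SkeletonUnit.
Variables (K : closedFieldType) (C : fusionCat K) (n : nat).
Local Notation G := 'I_n.+1.
Variables (w : G -> G -> G -> K) (X : G -> C)
  (mu : forall a b c, mor (X a \ox X b) (X c)).
Hypothesis sk : skeleton w mu.

Lemma sk_decomp S : exists m (d : 'I_m -> G), exists _ : decomp X d S, True.
Proof.
have [m [T [Ts TS]]] := fus_semisimple (fusP C) S.
have TX k : exists a, isomorphic (T k) (X a) by apply: (sk_surj sk).
exists m, (fun k => projT1 (cid (TX k))); apply: direct_sum_decomp TS => k.
by case: cid.
Qed.

Lemma sk_scalar a (f : mor (X a) (X a)) : exists s, f = s *: idm (X a).
Proof. by apply: schur_scalar (sk_simple sk a); apply: (fus_abelian (fusP C)). Qed.

Lemma sk_zero a b (f : mor (X a) (X b)) : a != b -> f = 0.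
Proof.
move=> ab; apply: schur_zero; first exact: fus_abelian (fusP C).
- exact: (sk_simple sk).
- exact: (sk_simple sk).
- by move=> /(sk_inj sk) E; rewrite E eqxx in ab.
Qed.

(** Associativity of [mu], solved for the inverses of [mu]. *)
Lemma sk_assocV a b c :
  massoc (X a) (X b) (X c) \oc (invm (mu a b (a + b)) \om idm (X c))
    \oc invm (mu (a + b) c (a + (b + c)))
  = w a b c *: ((idm (X a) \om invm (mu b c (b + c)))
    \oc invm (mu a (b + c) (a + (b + c)))).
Proof.
have mui a' b' c' : c' = a' + b' -> is_iso (mu a' b' c') := @sk_iso_eq _ _ _ _ _ _ sk a' b' c'.
have t1 : is_iso (mu (a + b) c (a + (b + c))) by apply: mui; rewrite addrA.
have t2 : is_iso (mu a b (a + b) \om idm (X c)).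
  by apply: tensm_is_iso; [apply: mui | apply: is_iso_id].
apply: (iso_cancel_r (is_iso_comp t1 t2)).
rewrite compmZl -compmZr -(sk_assoc sk) !compmA.
rewrite -[_ \oc _ \oc mu (a + b) _ _]compmA invmK // compm_idr -compmA.
rewrite -tensm_idr_comp invmK ?tensm_id ?compm_idr; last exact: mui.
rewrite -[X in X \oc _ \oc _]compmA invmK ?compm_idr; last exact: mui.
by rewrite -tensm_idl_comp invmK ?tensm_id ?compm_idl //; apply: mui.
Qed.

(** For a normalised cocycle the triangle axiom makes both unit constraints,
    restricted to the representatives, agree with [mu] up to one common scalar,
    which is absorbed into the identification of [X 0] with the unit. *)
Lemma sk_unitor : (forall a b, w a 0 b = 1) ->
  exists u : mor (X 0) munit, [/\ is_iso u,
    forall a, mlunit (X a) \oc (u \om idm (X a)) = mu 0 a a &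
    forall a, mrunit (X a) \oc (idm (X a) \om u) = mu a 0 a].
Proof.
move=> w1; have [u ui] := isomorphic_sym (sk_unit sk).
have abC := fus_abelian (fusP C).
have mu0i a : is_iso (mu 0 a a) by apply: (sk_iso_eq sk); rewrite add0r.
have mui0 a : is_iso (mu a 0 a) by apply: (sk_iso_eq sk); rewrite addr0.
have Lex a : exists s, mlunit (X a) \oc (u \om idm (X a)) = s *: mu 0 a a.
  by apply: schur_proportional => //; apply: (sk_simple sk).
have Rex a : exists s, mrunit (X a) \oc (idm (X a) \om u) = s *: mu a 0 a.
  by apply: schur_proportional => //; apply: (sk_simple sk).
pose L a := projT1 (cid (Lex a)); pose R a := projT1 (cid (Rex a)).
have LE a : mlunit (X a) \oc (u \om idm (X a)) = L a *: mu 0 a a.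
  by rewrite /L; case: cid.
have RE a : mrunit (X a) \oc (idm (X a) \om u) = R a *: mu a 0 a.
  by rewrite /R; case: cid.
have LR a b : L b = R a.
  have topi : is_iso (mu a b (a + b) \oc (mu a 0 a \om idm (X b))).
    apply: is_iso_comp; first exact: (sk_iso sk).
    by apply: tensm_is_iso => //; apply: is_iso_id.
  apply: (simple_scale_inj (sk_simple sk _) topi).
  rewrite -[in RHS]compmZr -tensmZl -RE tensm_idr_comp -mtriangle.
  rewrite -[_ \oc massoc _ _ _ \oc _]compmA massoc_nat !compmA.
  rewrite -[_ \oc (idm _ \om (u \om _))]compmA -tensm_idl_comp LE.
  rewrite tensmZr compmZr compmZl (sk_assoc_eq sk (ab := a)) ?addr0 ?add0r //.
  by rewrite w1 scale1r.
have L0 : L 0 != 0.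
  apply/eqP => L0; have := LE 0; rewrite L0 scale0r; apply/eqP/iso_neq0.
    exact: (sk_simple sk).
  by apply: is_iso_comp (mlunit_iso _) _; apply: tensm_is_iso => //; apply: is_iso_id.
exists ((L 0)^-1 *: u); split=> [|a|a].
- by apply: is_isoZ ui; rewrite invr_eq0.
- by rewrite tensmZl compmZr LE (LR 0 a) (LR 0 0) scalerA mulVf ?scale1r // -(LR 0 0).
- by rewrite tensmZr compmZr RE -(LR a 0) scalerA mulVf ?scale1r.
Qed.

End SkeletonUnit.

(** * Monoidal structure on a linear functor *)

(** Let [F] be a linear functor carrying each [X a] to an object isomorphic to
    [Y a]. On [X a] and [X b] the tensor constraint must be [nu] followed by the
    inverse of [mu]; it extends to all objects through decompositions. Each
    coherence axiom is an equality of morphisms out of tensor products of objects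
    [F S], and is tested on the summands [emb f]. *)
Section MonoidalStructure.
Variables (K : closedFieldType) (C D : fusionCat K) (n : nat).
Local Notation G := 'I_n.+1.
Variables (w : G -> G -> G -> K).
Variables (X : G -> C) (mu : forall a b c, mor (X a \ox X b) (X c)).
Variables (Y : G -> D) (nu : forall a b c, mor (Y a \ox Y b) (Y c)).
Hypotheses (sk : skeleton w mu) (sk' : skeleton w nu).
Variables (F : linFunctor C D) (theta : forall a, mor (Y a) (F (X a))).
Hypothesis thetai : forall a, is_iso (theta a).

Definition dsize S : nat := projT1 (cid (sk_decomp sk S)).
Definition deg S : 'I_(dsize S) -> G := projT1 (cid (projT2 (cid (sk_decomp sk S)))).
Definition dec S : decomp X (@deg S) S :=
  projT1 (cid (projT2 (cid (projT2 (cid (sk_decomp sk S)))))).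
Local Notation inj := (dinj (dec _)).
Local Notation prj := (dproj (dec _)).

Lemma dec_sum S : \sum_k (dinj (dec S) k \oc prj k) = idm S.
Proof. exact: dsum (dec S). Qed.

Local Notation V a b := (invm (mu a b (a + b))).

(** The inclusion into [F S], and the projection from it, that [F] induces on a
    summand; they are locked because unification would otherwise unfold them to
    compositions when rewriting with associativity. *)
Definition emb a S (f : mor (X a) S) : mor (Y a) (F S) := locked (fmap F f \oc theta a).
Definition ret a S (f : mor S (X a)) : mor (F S) (Y a) :=
  locked (invm (theta a) \oc fmap F f).

Lemma embE a S (f : mor (X a) S) : emb f = fmap F f \oc theta a.
Proof. by rewrite /emb -lock. Qed.

Lemma retE a S (f : mor S (X a)) : ret f = invm (theta a) \oc fmap F f.
Proof. by rewrite /ret -lock. Qed.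

Lemma fmap_emb a S S' (f : mor S S') (g : mor (X a) S) :
  fmap F f \oc emb g = emb (f \oc g).
Proof. by rewrite !embE fmap_comp compmA. Qed.

Lemma embZ a S s (f : mor (X a) S) : emb (s *: f) = s *: emb f.
Proof. by rewrite !embE fmapZ compmZl. Qed.

Lemma emb_sum a S (I : finType) (f : I -> mor (X a) S) :
  emb (\sum_i f i) = \sum_i emb (f i).
Proof. by rewrite embE fmap_sum compm_suml; apply: eq_bigr => i _; rewrite embE. Qed.

Lemma ret_emb a b S (f : mor S (X a)) (g : mor (X b) S) :
  ret f \oc emb g = ret (f \oc g) \oc theta b.
Proof. by rewrite embE !retE !fmap_comp !compmA. Qed.

Lemma emb_ret a S S' (f : mor (X a) S) (g : mor S' (X a)) :
  emb f \oc ret g = fmap F (f \oc g).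
Proof.
by rewrite !(embE, retE) compmA -[_ \oc invm _]compmA invmVK // compm_idr fmap_comp.
Qed.

Lemma emb_covers S : covers (fun k : 'I_(dsize S) => emb (inj k)).
Proof.
exists (fun k => ret (prj k)); rewrite -fmap_id -(dec_sum S) fmap_sum.
by apply: eq_bigr => k _; rewrite emb_ret.
Qed.

Definition Ften S S' : mor (F S \ox F S') (F (S \ox S')) :=
  \sum_(k < dsize S) \sum_(l < dsize S') (emb ((inj k \om inj l) \oc V (deg k) (deg l))
     \oc nu (deg k) (deg l) (deg k + deg l) \oc (ret (prj k) \om ret (prj l))).

Definition FtenV S S' : mor (F (S \ox S')) (F S \ox F S') :=
  \sum_(k < dsize S) \sum_(l < dsize S') ((emb (inj k) \om emb (inj l))
     \oc invm (nu (deg k) (deg l) (deg k + deg l))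
     \oc ret (mu (deg k) (deg l) (deg k + deg l) \oc (prj k \om prj l))).

(** Morphisms between representatives are scalars or zero, hence slide through
    [mu] and [nu] alike. *)
Lemma ret_slide a b a' b' (x : mor (X a) (X a')) (y : mor (X b) (X b')) :
  nu a' b' (a' + b') \oc ((ret x \oc theta a) \om (ret y \oc theta b))
  = ret (mu a' b' (a' + b') \oc (x \om y)) \oc emb (V a b) \oc nu a b (a + b).
Proof.
have [E|ne] := eqVneq a a'; last first.
  rewrite (sk_zero sk x ne) !retE fmap0 compm0 comp0m !tens0m !compm0.
  by rewrite fmap0 compm0 !comp0m.
have [E'|ne] := eqVneq b b'; last first.
  rewrite (sk_zero sk y ne) !retE fmap0 compm0 comp0m !tensm0 !compm0.
  by rewrite fmap0 compm0 !comp0m.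
case: a' / E x => x; case: b' / E' y => y.
have [s ->] := sk_scalar sk x; have [t ->] := sk_scalar sk y.
rewrite !(tensmZl, tensmZr, compmZr, compmZl) tensm_id compm_idr !retE.
rewrite !(fmapZ, compmZr, compmZl, tensmZl, tensmZr) !fmap_id !compm_idr.
rewrite !invmK // tensm_id compm_idr !embE.
rewrite [_ \oc (_ \oc theta _)]compmA -[_ \oc fmap F (V a b)]compmA -fmap_comp.
by rewrite (invmVK (sk_iso sk a b)) fmap_id compm_idr invmK // compm_idl.
Qed.

(** The defining property of the tensor constraint, valid for every pair of
    morphisms from representatives and not only for the inclusions of the chosen
    decompositions. *)
Lemma Ften_emb S S' a b c (f : mor (X a) S) (g : mor (X b) S') : c = a + b ->
  Ften S S' \oc (emb f \om emb g) = emb ((f \om g) \oc invm (mu a b c)) \oc nu a b c.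
Proof.
move=> ->; rewrite -[f in RHS]compm_idl -[g in RHS]compm_idl -(dec_sum S) -(dec_sum S').
rewrite !compm_suml tensm_suml compm_suml emb_sum compm_suml.
apply: eq_bigr => k _; rewrite tensm_sumr !compm_suml emb_sum compm_suml.
apply: eq_bigr => l _; rewrite -!compmA -tensm_comp.
rewrite !ret_emb ret_slide !compmA emb_ret fmap_emb; congr (emb _ \oc _); rewrite !compmA.
rewrite -[_ \oc V (deg k) (deg l) \oc _]compmA invmK ?compm_idr; last exact: sk_iso sk _ _.
by rewrite -tensm_comp !compmA.
Qed.

Lemma Ften_iso S S' : is_iso (Ften S S').
Proof.
exists (FtenV S S'); split; last first.
  rewrite /FtenV compm_sumr -fmap_id -tensm_id -(dec_sum S) -(dec_sum S') tensm_suml.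
  rewrite fmap_sum; apply: eq_bigr => k _; rewrite tensm_sumr fmap_sum compm_sumr.
  apply: eq_bigr => l _; rewrite !compmA (Ften_emb _ _ erefl) -[_ \oc nu _ _ _ \oc _]compmA.
  rewrite invmVK ?compm_idr; last exact: sk_iso sk' _ _.
  rewrite emb_ret compmA -[_ \oc invm _ \oc _]compmA invmK ?compm_idr ?tensm_comp //.
  exact: sk_iso sk _ _.
apply: (covers_test (covers_tens (emb_covers S) (emb_covers S'))) => -[k0 l0] /=.
set f := inj k0; set g := inj l0; rewrite compm_idl -compmA (Ften_emb _ _ erefl) compmA.
transitivity (\sum_(k < dsize S) \sum_(l < dsize S') ((emb (inj k) \om emb (inj l)) \oc
   ((ret (prj k \oc f) \oc theta _) \om (ret (prj l \oc g) \oc theta _)))).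
  rewrite /FtenV !compm_suml; apply: eq_bigr => k _; rewrite !compm_suml.
  apply: eq_bigr => l _; rewrite -!compmA; congr (_ \oc _).
  apply: (iso_cancel_l (sk_iso sk' _ _)); rewrite ret_slide !compmA.
  rewrite invmVK ?compm_idl; last exact: sk_iso sk' _ _.
  by rewrite !ret_emb tensm_comp !compmA.
transitivity ((\sum_(k < dsize S) (emb (inj k) \oc ret (prj k) \oc emb f)) \om
              (\sum_(l < dsize S') (emb (inj l) \oc ret (prj l) \oc emb g))).
  rewrite tensm_suml; apply: eq_bigr => k _; rewrite tensm_sumr.
  apply: eq_bigr => l _; rewrite -tensm_comp -!compmA.
  by rewrite !ret_emb.
rewrite -!compm_suml; congr (_ \om _).
  by rewrite (eq_bigr _ (fun k _ => emb_ret _ _)) -fmap_sum dec_sum fmap_id compm_idl.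
by rewrite (eq_bigr _ (fun k _ => emb_ret _ _)) -fmap_sum dec_sum fmap_id compm_idl.
Qed.

Lemma Ften_nat S S' R R' (f : mor S S') (g : mor R R') :
  Ften S' R' \oc (fmap F f \om fmap F g) = fmap F (f \om g) \oc Ften S R.
Proof.
apply: (covers_test (covers_tens (emb_covers S) (emb_covers R))) => -[k l] /=.
rewrite -!compmA -tensm_comp !fmap_emb !(Ften_emb _ _ erefl) compmA fmap_emb compmA.
by rewrite -tensm_comp.
Qed.

Lemma Ften_embl S S' a b c Z (f : mor (X a) S) (g : mor (X b) S') (h : mor Z (Y a)) :
  c = a + b -> Ften S S' \oc ((emb f \oc h) \om emb g) =
    emb ((f \om g) \oc invm (mu a b c)) \oc nu a b c \oc (h \om idm (Y b)).
Proof. by move=> E; rewrite -(Ften_emb _ _ E) -compmA -tensm_comp compm_idr. Qed.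

Lemma Ften_embr S S' a b c Z (f : mor (X a) S) (g : mor (X b) S') (h : mor Z (Y b)) :
  c = a + b -> Ften S S' \oc (emb f \om (emb g \oc h)) =
    emb ((f \om g) \oc invm (mu a b c)) \oc nu a b c \oc (idm (Y a) \om h).
Proof. by move=> E; rewrite -(Ften_emb _ _ E) -compmA -tensm_comp compm_idr. Qed.

Lemma Ften_assoc S S' S'' :
  fmap F (massoc S S' S'') \oc Ften (S \ox S') S'' \oc (Ften S S' \om idm (F S'')) =
  Ften S (S' \ox S'') \oc (idm (F S) \om Ften S' S'') \oc massoc (F S) (F S') (F S'').
Proof.
apply: (covers_test (covers_tens
  (covers_tens (emb_covers S) (emb_covers S')) (emb_covers S''))) => -[[k l] m] /=.
set a := deg k; set b := deg l; set c := deg m.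
rewrite -[LHS]compmA -[RHS]compmA -tensm_comp massoc_nat compm_idl.
rewrite [RHS]compmA -[_ \oc (idm (F S) \om _) \oc _]compmA -tensm_comp compm_idl.
rewrite (Ften_emb _ _ (erefl (a + b))) (Ften_emb _ _ (erefl (b + c))).
rewrite -[LHS]compmA (Ften_embl _ _ _ (addrA a b c)) (Ften_embr _ _ _ (erefl (a + (b + c)))).
rewrite [LHS]compmA [in LHS]compmA -[RHS]compmA fmap_emb.
rewrite -[RHS]compmA [nu a _ _ \oc _]compmA (sk_assoc sk').
rewrite compmZr -compmZl -embZ -[LHS]compmA.
congr (emb _ \oc _).
rewrite -{1}[inj m]compm_idr tensm_comp -[in RHS](compm_idr (inj k)) tensm_comp.
rewrite !compmA massoc_nat -!compmA -compmZr; congr (_ \oc _).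
by rewrite compmA (sk_assocV sk).
Qed.

Variables (u : mor (X 0) munit) (v : mor (Y 0) munit).
Hypotheses (ui : is_iso u) (vi : is_iso v).
Hypothesis ul : forall a, mlunit (X a) \oc (u \om idm (X a)) = mu 0 a a.
Hypothesis ur : forall a, mrunit (X a) \oc (idm (X a) \om u) = mu a 0 a.
Hypothesis vl : forall a, mlunit (Y a) \oc (v \om idm (Y a)) = nu 0 a a.
Hypothesis vr : forall a, mrunit (Y a) \oc (idm (Y a) \om v) = nu a 0 a.

Definition mon_unit : mor munit (F munit) := emb u \oc invm v.

Lemma mon_unit_iso : is_iso mon_unit.
Proof.
apply: is_iso_comp; last exact: is_iso_inv.
by rewrite embE; apply: is_iso_comp => //; apply: fmap_iso.
Qed.

Lemma mon_lunit S :
  fmap F (mlunit S) \oc Ften munit S \oc (mon_unit \om idm (F S)) = mlunit (F S).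
Proof.
apply: (covers_test (covers_tens (covers_id _) (emb_covers S))) => -[[] k] /=.
apply: (iso_cancel_r (tensm_is_iso vi (is_iso_id _))).
rewrite -!compmA -!tensm_comp compm_idr !compm_idl -compmA invmK // compm_idr.
rewrite (Ften_emb u _ (esym (add0r (deg k)))) compmA fmap_emb.
rewrite -[emb (inj k) in RHS]compm_idr -[v in RHS]compm_idl tensm_comp.
rewrite [RHS]compmA mlunit_nat -compmA vl; congr (_ \oc _).
rewrite -[inj k in LHS]compm_idr -[u]compm_idl tensm_comp !compmA mlunit_nat.
rewrite -[_ \oc (u \om _)]compmA ul -compmA invmVK ?compm_idr //.
by apply: (sk_iso_eq sk); rewrite add0r.
Qed.

Lemma mon_runit S :
  fmap F (mrunit S) \oc Ften S munit \oc (idm (F S) \om mon_unit) = mrunit (F S).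
Proof.
apply: (covers_test (covers_tens (emb_covers S) (covers_id _))) => -[k []] /=.
apply: (iso_cancel_r (tensm_is_iso (is_iso_id _) vi)).
rewrite -!compmA -!tensm_comp compm_idr !compm_idl -compmA invmK // compm_idr.
rewrite (Ften_emb _ u (esym (addr0 (deg k)))) compmA fmap_emb.
rewrite -[emb (inj k) in RHS]compm_idr -[v in RHS]compm_idl tensm_comp.
rewrite [RHS]compmA mrunit_nat -compmA vr; congr (_ \oc _).
rewrite -[inj k in LHS]compm_idr -[u]compm_idl tensm_comp !compmA mrunit_nat.
rewrite -[_ \oc (_ \om u)]compmA ur -compmA invmVK ?compm_idr //.
by apply: (sk_iso_eq sk); rewrite addr0.
Qed.

End MonoidalStructure.

Section MonoidalExtension.
Variables (K : closedFieldType) (C D : fusionCat K) (n : nat).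
Local Notation G := 'I_n.+1.

Lemma monoidal_extension (w : G -> G -> G -> K) X mu Y nu (F : linFunctor C D) :
  @skeleton K C n w X mu -> @skeleton K D n w Y nu -> (forall a b, w a 0 b = 1) ->
  (forall a, isomorphic (Y a) (F (X a))) ->
  exists M : monFunctor C D, mfun M = F.
Proof.
move=> sk sk' w1 YX; pose theta a := projT1 (cid (YX a)).
have thetai a : is_iso (theta a) by rewrite /theta; case: cid.
have [u [ui ul ur]] := sk_unitor sk w1; have [v [vi vl vr]] := sk_unitor sk' w1.
by exists (MonFunctor (Ften_iso sk sk' thetai) (mon_unit_iso thetai ui vi)
  (Ften_nat nu sk thetai) (Ften_assoc sk sk' thetai) (mon_lunit sk thetai vi ul vl)
  (mon_runit sk thetai vi ur vr)).
Qed.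

End MonoidalExtension.

(** * The linear equivalence determined by matrix entries *)

Section Transfer.
Variables (K : closedFieldType) (n : nat).
Local Notation G := 'I_n.+1.

(** A matrix unit, total in [a] and [b] so that scalars can be carried from [C] to
    [D] without transport along [a = b]. *)
Definition unit_entry (C : linCat K) (X : G -> C) a b : mor (X a) (X b) :=
  if a =P b is ReflectT e then ecast b (mor (X a) (X b)) e (idm (X a)) else 0.

Lemma unit_entry_id (C : linCat K) (X : G -> C) a : unit_entry X a a = idm (X a).
Proof.
by rewrite /unit_entry; case: eqP => // e; rewrite (eq_irrelevance e erefl).
Qed.

Lemma unit_entry_neq (C : linCat K) (X : G -> C) a b : a != b -> unit_entry X a b = 0.
Proof. by rewrite /unit_entry; case: eqP. Qed.

Section Coefficients.
Variables (C : fusionCat K) (w : G -> G -> G -> K) (X : G -> C)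
  (mu : forall a b c, mor (X a \ox X b) (X c)) (sk : skeleton w mu).

Lemma coef_ex a b (f : mor (X a) (X b)) :
  exists s, f = s *: unit_entry X a b /\ (a != b -> s = 0).
Proof.
have [E|ne] := eqVneq a b; last by exists 0; rewrite scale0r (sk_zero sk f ne).
case: b / E f => f; have [s ->] := sk_scalar sk f.
by exists s; rewrite unit_entry_id.
Qed.

Definition coef a b (f : mor (X a) (X b)) : K := projT1 (cid (coef_ex f)).

Lemma coefE a b (f : mor (X a) (X b)) : f = coef f *: unit_entry X a b.
Proof. by rewrite /coef; case: cid => s []. Qed.

Lemma coef_neq a b (f : mor (X a) (X b)) : a != b -> coef f = 0.
Proof. by rewrite /coef; case: cid => s []. Qed.

Lemma coefP a (f : mor (X a) (X a)) s : f = s *: idm (X a) -> coef f = s.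
Proof.
move=> E; apply: (simple_scale_inj (sk_simple sk a) (is_iso_id (X a))).
by rewrite -E -(unit_entry_id X) -coefE.
Qed.

Lemma coef_lin a b s (f g : mor (X a) (X b)) :
  coef (s *: f + g) = s * coef f + coef g.
Proof.
have [E|ne] := eqVneq a b; last by rewrite !coef_neq // mulr0 addr0.
case: b / E f g => f g; apply: coefP; rewrite scalerDl -scalerA.
by rewrite -(unit_entry_id X) -!coefE.
Qed.

Lemma coef_comp a b c (g : mor (X b) (X c)) (f : mor (X a) (X b)) :
  coef (g \oc f) = coef g * coef f.
Proof.
have [E|ne] := eqVneq a b; last first.
  rewrite (sk_zero sk f ne) compm0 [X in _ * X]coef_neq // mulr0.
  have [E|ne'] := eqVneq a c; last by rewrite coef_neq.
  by case: c / E g => g; apply: coefP; rewrite scale0r.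
case: b / E g f => g f.
have [E|ne] := eqVneq a c; last by rewrite !(coef_neq _ ne) mul0r.
case: c / E g => g; apply: coefP.
by rewrite {1}[g]coefE {1}[f]coefE unit_entry_id compmZl compmZr compm_idl scalerA.
Qed.

End Coefficients.

Variables (C D : fusionCat K) (w w' : G -> G -> G -> K).
Variables (X : G -> C) (mu : forall a b c, mor (X a \ox X b) (X c)).
Variables (Y : G -> D) (nu : forall a b c, mor (Y a \ox Y b) (Y c)).
Hypotheses (sk : skeleton w mu) (sk' : skeleton w' nu).

(** Morphisms between representatives are scalars in both categories, so they
    can be copied from [C] to [D]. *)
Definition transfer a b (f : mor (X a) (X b)) : mor (Y a) (Y b) :=
  coef sk f *: unit_entry Y a b.

Lemma transfer_lin a b s (f g : mor (X a) (X b)) :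
  transfer (s *: f + g) = s *: transfer f + transfer g.
Proof. by rewrite /transfer coef_lin scalerDl scalerA. Qed.

Lemma transfer0 a b : transfer (0 : mor (X a) (X b)) = 0.
Proof.
have := transfer_lin (-1) 0 (0 : mor (X a) (X b)).
by rewrite scaleN1r oppr0 addr0 scaleN1r addNr.
Qed.

Lemma transferD a b (f g : mor (X a) (X b)) :
  transfer (f + g) = transfer f + transfer g.
Proof. by have := transfer_lin 1 f g; rewrite !scale1r. Qed.

Lemma transfer_sum a b (I : finType) (f : I -> mor (X a) (X b)) :
  transfer (\sum_i f i) = \sum_i transfer (f i).
Proof. exact: (big_morph _ (@transferD a b) (transfer0 a b)). Qed.

Lemma transfer_id a : transfer (idm (X a)) = idm (Y a).
Proof.
by rewrite /transfer (coefP sk (s := 1)) ?scale1r ?unit_entry_id.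
Qed.

Lemma transfer_comp a b c (g : mor (X b) (X c)) (f : mor (X a) (X b)) :
  transfer (g \oc f) = transfer g \oc transfer f.
Proof.
have [E|ne] := eqVneq a b; last by rewrite (sk_zero sk f ne) compm0 !transfer0 compm0.
case: b / E g f => g f.
have [E|ne] := eqVneq a c; last by rewrite (sk_zero sk g ne) comp0m !transfer0 comp0m.
case: c / E g => g; rewrite /transfer coef_comp unit_entry_id.
by rewrite compmZl compmZr compm_idl scalerA.
Qed.

Lemma transfer_inj a b (f g : mor (X a) (X b)) : transfer f = transfer g -> f = g.
Proof.
have [E|ne] := eqVneq a b; last by rewrite (sk_zero sk f ne) (sk_zero sk g ne).
case: b / E f g => f g; rewrite /transfer unit_entry_id.
move/(simple_scale_inj (sk_simple sk' a) (is_iso_id _)) => E.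
by rewrite (coefE sk f) (coefE sk g) E.
Qed.

Lemma transfer_surj a b (g : mor (Y a) (Y b)) : exists f, transfer f = g.
Proof.
exists (coef sk' g *: unit_entry X a b); rewrite [RHS](coefE sk').
rewrite /transfer; have [E|ne] := eqVneq a b; last by rewrite !unit_entry_neq // !scaler0.
by case: b / E g => g; rewrite (coefP sk (s := coef sk' g)) // unit_entry_id.
Qed.

(** The relation between objects of [C] and of [D] that the functor realises. *)
Record matched (S : C) (T : D) := Matched {
  msize : nat;
  mdeg : 'I_msize -> G;
  mleft : decomp X mdeg S;
  mright : decomp Y mdeg T
}.

Section Blocks.
Variables (S S' : C) (T T' : D) (A : matched S T) (B : matched S' T').

(** The morphism whose matrix entries are copied from those of [f]. *)
Definition block (f : mor S S') : mor T T' :=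
  of_entries (mright A) (mright B)
    (fun l k => transfer (dproj (mleft B) l \oc f \oc dinj (mleft A) k)).

Lemma blockE f l k :
  dproj (mright B) l \oc block f \oc dinj (mright A) k =
  transfer (dproj (mleft B) l \oc f \oc dinj (mleft A) k).
Proof. exact: of_entriesE. Qed.

Lemma block_lin s f g : block (s *: f + g) = s *: block f + block g.
Proof.
apply: (entries_inj (dS := mright A) (dS' := mright B)) => l k.
rewrite blockE compm_linr compm_linl transfer_lin.
by rewrite compm_linr compm_linl !blockE.
Qed.

Lemma block_inj f g : block f = block g -> f = g.
Proof.
move=> E; apply: (entries_inj (dS := mleft A) (dS' := mleft B)) => l k.
by apply: transfer_inj; rewrite -!blockE E.
Qed.

Lemma block_surj g : exists f, block f = g.
Proof.
pose M l k := projT1 (cid (transfer_surj (dproj (mright B) l \oc g \oc dinj (mright A) k))).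
have ME l k : transfer (M l k) = dproj (mright B) l \oc g \oc dinj (mright A) k.
  by rewrite /M; case: cid.
exists (of_entries (mleft A) (mleft B) M).
apply: (entries_inj (dS := mright A) (dS' := mright B)) => l k.
by rewrite blockE of_entriesE ME.
Qed.

End Blocks.

Lemma block_comp S S' S'' T T' T'' (A : matched S T) (B : matched S' T')
    (E : matched S'' T'') (g : mor S' S'') (f : mor S S') :
  block A E (g \oc f) = block B E g \oc block A B f.
Proof.
apply: (entries_inj (dS := mright A) (dS' := mright E)) => l k.
rewrite blockE -[block B E g]compm_idr -(dsum (mright B)).
rewrite -[g in LHS]compm_idr -(dsum (mleft B)).
rewrite !(compm_suml, compm_sumr) transfer_sum; apply: eq_bigr => m _.
transitivity (transfer (dproj (mleft E) l \oc g \oc dinj (mleft B) m \oc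
   (dproj (mleft B) m \oc f \oc dinj (mleft A) k))); first by rewrite !compmA.
by rewrite transfer_comp -!blockE !compmA.
Qed.

Lemma block_id S T (A : matched S T) : block A A (idm S) = idm T.
Proof.
apply: (entries_inj (dS := mright A) (dS' := mright A)) => l k.
rewrite blockE !compm_idr.
have [->|ne] := eqVneq k l; first by rewrite !dprojK transfer_id.
by rewrite !dproj0 // transfer0.
Qed.

Lemma matched_isomorphic S T T' : matched S T -> matched S T' -> isomorphic T T'.
Proof.
move=> A B; exists (block A B (idm S)), (block B A (idm S)).
by rewrite -!block_comp compm_idl !block_id.
Qed.

Lemma direct_sum_ex (E : fusionCat K) (Z : G -> E) m (d : 'I_m -> G) :
  exists T, exists _ : decomp Z d T, True.
Proof.
have [T TS] := ab_dirsum (fus_abelian (fusP E)) (fun k => Z (d k)).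
by exists T; apply: direct_sum_decomp TS => k; apply: isomorphic_refl.
Qed.

Lemma matched_right S : exists T, exists _ : matched S T, True.
Proof.
have [m [d [dS _]]] := sk_decomp sk S; have [T [dT _]] := direct_sum_ex Y d.
by exists T, (Matched dS dT).
Qed.

Lemma matched_left T : exists S, exists _ : matched S T, True.
Proof.
have [m [d [dT _]]] := sk_decomp sk' T; have [S [dS _]] := direct_sum_ex X d.
by exists S, (Matched dS dT).
Qed.

Lemma matched_simple a : exists _ : matched (X a) (Y a), True.
Proof.
have [dS _] := decomp_self X a; have [dT _] := decomp_self Y a.
by exists (Matched dS dT).
Qed.

(** [F S] is any object matched with [S], and [F] acts on morphisms by [block].
    Objects matched with the same object are isomorphic, which yields both
    essential surjectivity and the values on the representatives. *)
Lemma transfer_functor : exists F : linFunctor C D,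
  is_equivalence F /\ forall a, isomorphic (Y a) (F (X a)).
Proof.
pose Fo S := projT1 (cid (matched_right S)).
have FM S : matched S (Fo S) := projT1 (cid (projT2 (cid (matched_right S)))).
pose F := LinFunctor (fun S S' => @block_lin S S' _ _ (FM S) (FM S'))
  (fun S => block_id (FM S))
  (fun S S' S'' => @block_comp S S' S'' _ _ _ (FM S) (FM S') (FM S'')).
exists F; split=> [|a].
  apply: ff_equivalence; first split=> [S S' f g|S S' g].
  - exact: block_inj.
  - exact: block_surj.
  - move=> T; have [S [A _]] := matched_left T.
    by exists S; apply: matched_isomorphic (FM S) A.
by have [A _] := matched_simple a; apply: matched_isomorphic A (FM (X a)).
Qed.

End Transfer.

(** Skeletal presentations with the same normalised cocycle exhibit the two
    categories as monoidally equivalent. *)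
Lemma skeleton_equivalent (K : closedFieldType) (n : nat) (C D : fusionCat K)
    (w : 'I_n.+1 -> 'I_n.+1 -> 'I_n.+1 -> K) X mu Y nu :
  @skeleton K C n w X mu -> @skeleton K D n w Y nu -> (forall a b, w a 0 b = 1) ->
  mon_equivalent C D.
Proof.
move=> sk sk' w1; have [F [Feq YF]] := transfer_functor sk sk'.
by have [M MF] := monoidal_extension sk sk' w1 YF; exists M; rewrite MF.
Qed.

Lemma has_type_equivalent (K : closedFieldType) (n : nat) (C D : fusionCat K) z :
  @has_type K C n z -> @has_type K D n z -> mon_equivalent C D.
Proof.
move=> [_ [X [mu sk]]] [_ [Y [nu sk']]]; apply: skeleton_equivalent sk sk' _ => a b.
by rewrite /std3 add0n divn_small ?muln0.
Qed.

(** * The category of graded matrices *)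

(** If every [f] has a generalised inverse [g], kernels and cokernels are
    obtained by splitting the idempotents [1 - g f] and [1 - f g]. *)
Lemma abelian_of_regular (K : fieldType) (C : linCat K) :
  (forall m (S : 'I_m -> C), exists X, is_direct_sum S X) ->
  (forall (X Y : C) (f : mor X Y), exists g, f \oc g \oc f = f) ->
  (forall (X : C) (e : mor X X), e \oc e = e -> exists Z (k : mor Z X) (r : mor X Z),
     r \oc k = idm Z /\ k \oc r = e) ->
  is_abelian C.
Proof.
move=> sums reg split_idem.
have idemC (X : C) (e : mor X X) : e \oc e = e -> (idm X - e) \oc (idm X - e) = idm X - e.
  by move=> ee; rewrite compmBl !compmBr !compm_idl compm_idr ee subrr subr0.
split=> // [X Y f|X Y f|X Y f fm|X Y f fe]; have [g fgf] := reg _ _ f.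
- have gfK : (g \oc f) \oc (g \oc f) = g \oc f by rewrite -compmA [f \oc _]compmA fgf.
  have [Z [k [r [rk kr]]]] := split_idem _ _ (idemC _ _ gfK); exists Z, k; split.
    rewrite -[f \oc k]compm_idr -rk compmA -[f \oc k \oc r]compmA kr compmBr compm_idr.
    by rewrite compmA fgf subrr comp0m.
  move=> W h fh; exists (r \oc h); split=> [|u <-].
    by rewrite compmA kr compmBl compm_idl -compmA fh compm0 subr0.
  by rewrite compmA rk compm_idl.
- have fgK : (f \oc g) \oc (f \oc g) = f \oc g by rewrite compmA fgf.
  have [Z [k [r [rk kr]]]] := split_idem _ _ (idemC _ _ fgK); exists Z, r; split.
    rewrite -[r \oc f]compm_idl -rk -compmA [k \oc (r \oc f)]compmA kr compmBl compm_idl.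
    by rewrite fgf subrr compm0.
  move=> W h hf; exists (h \oc k); split=> [|u <-].
    by rewrite -compmA kr compmBr compm_idr compmA hf comp0m subr0.
  by rewrite -compmA rk compm_idr.
- exists Y, (idm Y - f \oc g); split.
    by rewrite compmBl compm_idl fgf subrr.
  move=> W h /eqP; rewrite compmBl compm_idl subr_eq0 => /eqP hE.
  exists (g \oc h); split=> [|u uE]; first by rewrite compmA -hE.
  by apply: fm; rewrite compmA uE.
- exists X, (idm X - g \oc f); split.
    by rewrite compmBr compm_idr compmA fgf subrr.
  move=> W h /eqP; rewrite compmBr compm_idr subr_eq0 => /eqP hE.
  exists (h \oc g); split=> [|u uE]; first by rewrite -compmA -hE.
  by apply: fe; rewrite -compmA uE.
Qed.

Section GradedMatrices.
Variables (K : fieldType) (n : nat).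
Local Notation G := 'I_n.+1.

(** A finite-dimensional graded vector space is given by a finite homogeneous
    basis; morphisms are matrices indexed by pairs of equal degree. *)
Record gset := GSet { gcarrier :> finType; gdeg : gcarrier -> G }.
Implicit Types S T U : gset.

Definition gmor S T : vectType K :=
  {ffun {x : T * S | gdeg x.1 == gdeg x.2} -> K^o}.

Definition entry S T (f : gmor S T) (t : T) (s : S) : K :=
  if insub (t, s) is Some u then f u else 0.

Definition gmx S T (M : T -> S -> K) : gmor S T := [ffun u => M (val u).1 (val u).2].

Lemma entry_gmx S T (M : T -> S -> K) t s :
  entry (gmx M) t s = if gdeg t == gdeg s then M t s else 0.
Proof.
rewrite /entry; case: insubP => [[x xE] /= -> uE|/= /negbTE-> //].
by rewrite ffunE /= uE.
Qed.

Lemma entry_gmx_deg S T (M : T -> S -> K) t s :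
  (gdeg t != gdeg s -> M t s = 0) -> entry (gmx M) t s = M t s.
Proof. by rewrite entry_gmx; case: eqP => // _ ->. Qed.

Lemma entry_deg S T (f : gmor S T) t s : gdeg t != gdeg s -> entry f t s = 0.
Proof. by rewrite /entry; case: insubP => // u /= ->. Qed.

Lemma entry_inj S T (f g : gmor S T) : (forall t s, entry f t s = entry g t s) -> f = g.
Proof.
move=> E; apply/ffunP => -[[t s] ts]; have := E t s; rewrite /entry /=.
by rewrite !insubT.
Qed.

Lemma entry_lin S T a (f g : gmor S T) t s :
  entry (a *: f + g) t s = a * entry f t s + entry g t s.
Proof.
by rewrite /entry; case: insubP => [u _ _|_]; rewrite ?mulr0 ?addr0 // !ffunE.
Qed.

Lemma entry0 S T t s : entry (0 : gmor S T) t s = 0.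
Proof. by rewrite /entry; case: insubP => // u _ _; rewrite ffunE. Qed.

Lemma entryD S T (f g : gmor S T) t s : entry (f + g) t s = entry f t s + entry g t s.
Proof. by have := entry_lin 1 f g t s; rewrite scale1r mul1r. Qed.

Lemma entry_sum S T (I : finType) (f : I -> gmor S T) t s :
  entry (\sum_i f i) t s = \sum_i entry (f i) t s.
Proof. by elim/big_rec2: _ => [|i x y _ <-]; rewrite ?entry0 ?entryD. Qed.

Definition gid S : gmor S S := gmx (fun t s => (t == s)%:R).

Lemma entry_id S t s : entry (gid S) t s = (t == s)%:R.
Proof. by apply: entry_gmx_deg; have [->|//] := eqVneq t s; rewrite eqxx. Qed.

Definition gcomp S T U (g : gmor T U) (f : gmor S T) : gmor S U :=
  gmx (fun u s => \sum_t entry g u t * entry f t s).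

Lemma entry_comp S T U (g : gmor T U) (f : gmor S T) u s :
  entry (gcomp g f) u s = \sum_t entry g u t * entry f t s.
Proof.
apply: entry_gmx_deg => us; apply: big1 => t _.
have [ut|ut] := eqVneq (gdeg u) (gdeg t); last by rewrite entry_deg ?mul0r.
by rewrite [entry f t s]entry_deg ?mulr0 // -ut.
Qed.

Lemma gcomp_linl S T U a (g g' : gmor T U) (f : gmor S T) :
  gcomp (a *: g + g') f = a *: gcomp g f + gcomp g' f.
Proof.
apply: entry_inj => u s; rewrite entry_lin !entry_comp mulr_sumr -big_split.
by apply: eq_bigr => t _; rewrite entry_lin mulrDl mulrA.
Qed.

Lemma gcomp_linr S T U a (g : gmor T U) (f f' : gmor S T) :
  gcomp g (a *: f + f') = a *: gcomp g f + gcomp g f'.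
Proof.
apply: entry_inj => u s; rewrite entry_lin !entry_comp mulr_sumr -big_split.
by apply: eq_bigr => t _; rewrite entry_lin mulrDr mulrCA.
Qed.

Lemma gcomp_idl S T (f : gmor S T) : gcomp (gid T) f = f.
Proof.
apply: entry_inj => t s; rewrite entry_comp (bigD1 t) //= entry_id eqxx mul1r.
by rewrite big1 ?addr0 // => t' t't; rewrite entry_id eq_sym (negbTE t't) mul0r.
Qed.

Lemma gcomp_idr S T (f : gmor S T) : gcomp f (gid S) = f.
Proof.
apply: entry_inj => t s; rewrite entry_comp (bigD1 s) //= entry_id eqxx mulr1.
by rewrite big1 ?addr0 // => s' s's; rewrite entry_id (negbTE s's) mulr0.
Qed.

Lemma gcompA S T U V (h : gmor U V) (g : gmor T U) (f : gmor S T) :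
  gcomp h (gcomp g f) = gcomp (gcomp h g) f.
Proof.
apply: entry_inj => v s; rewrite !entry_comp.
under eq_bigr do rewrite entry_comp mulr_sumr.
rewrite exchange_big; apply: eq_bigr => t _; rewrite entry_comp mulr_suml.
by apply: eq_bigr => u _; rewrite mulrA.
Qed.

Definition gcat : linCat K :=
  LinCat gcomp_linl gcomp_linr gcomp_idl gcomp_idr gcompA.

(** Truncating a matrix to its degree-preserving part does not affect its
    products with degree-preserving matrices in entries of equal degrees. *)
Lemma entry_comp_gmxr S T U (g : gmor T U) (M : T -> S -> K) u s :
  entry (gcomp g (gmx M)) u s =
  if gdeg u == gdeg s then \sum_t entry g u t * M t s else 0.
Proof.
case: ifPn => us; last by rewrite entry_deg.
rewrite entry_comp; apply: eq_bigr => t _; rewrite entry_gmx.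
case: ifPn => // ts; rewrite entry_deg ?mul0r //; apply: contra ts => /eqP <-.
exact: us.
Qed.

Lemma entry_comp_gmxl S T U (M : U -> T -> K) (f : gmor S T) u s :
  entry (gcomp (gmx M) f) u s =
  if gdeg u == gdeg s then \sum_t M u t * entry f t s else 0.
Proof.
case: ifPn => us; last by rewrite entry_deg.
rewrite entry_comp; apply: eq_bigr => t _; rewrite entry_gmx.
case: ifPn => // ts; rewrite [entry f t s]entry_deg ?mulr0 //; apply: contra ts => /eqP ->.
exact: us.
Qed.

Definition plain_mx S T (f : gmor S T) : 'M[K]_(#|T|, #|S|) :=
  \matrix_(i, j) entry f (enum_val i) (enum_val j).

Lemma sum_enum_val (I : finType) (F : I -> K) :
  \sum_i F i = \sum_(i < #|I|) F (enum_val i).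
Proof. exact: reindex (onW_bij _ (enum_val_bij I)). Qed.

(** The degree-preserving part of a pseudo-inverse of the plain matrix of [f] is
    again one, as [f] preserves degrees. *)
Lemma gcat_regular S T (f : gmor S T) : exists g, gcomp (gcomp f g) f = f.
Proof.
pose P := pinvmx (plain_mx f); exists (gmx (fun s t => P (enum_rank s) (enum_rank t))).
apply: entry_inj => t s; rewrite -gcompA entry_comp.
have [ts|ts] := boolP (gdeg t == gdeg s); last first.
  rewrite [RHS]entry_deg // big1 // => r _.
  have [tr|tr] := eqVneq (gdeg t) (gdeg r); last by rewrite entry_deg ?mul0r.
  by rewrite [X in _ * X]entry_deg ?mulr0 // -tr.
transitivity (\sum_r entry f t r * \sum_v P (enum_rank r) (enum_rank v) * entry f v s).
  apply: eq_bigr => r _; rewrite entry_comp_gmxl; case: ifPn => // rs.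
  by rewrite entry_deg ?mul0r //; apply: contra rs => /eqP <-.
have /matrixP/(_ (enum_rank t) (enum_rank s)) := mulmxKpV (submx_refl (plain_mx f)).
rewrite -mulmxA !mxE !enum_rankK => <-; rewrite sum_enum_val; apply: eq_bigr => i _.
rewrite !mxE !enum_rankK enum_valK sum_enum_val; congr (_ * _).
by apply: eq_bigr => j _; rewrite !mxE enum_valK enum_rankK.
Qed.

(** A maximal set of independent rows of [e] is a homogeneous basis of its row
    space. These rows form [r]; expressing the rows of [e] through them, and
    keeping the degree-preserving part, gives [k]. *)
Lemma gcat_split S (e : gmor S S) : gcomp e e = e ->
  exists Z (k : gmor Z S) (r : gmor S Z), gcomp r k = gid Z /\ gcomp k r = e.
Proof.
move=> ee; pose E := plain_mx e; pose c (i : 'I_(\rank E)) : 'I_#|S| := maxrankfun E i.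
pose Z := GSet (fun i : 'I_(\rank E) => gdeg (enum_val (c i))).
pose r : gmor S Z := gmx (fun (i : Z) s => entry e (enum_val (c i)) s).
have rE (i : Z) s : entry r i s = entry e (enum_val (c i)) s.
  by apply: entry_gmx_deg => /= ne; rewrite entry_deg.
pose B := rowsub c E.
have /row_freeP[B' BB'] : row_free B := maxrowsub_free E.
have /submxP[R ER] : (E <= B)%MS by rewrite eq_maxrowsub.
pose q : gmor Z S := gmx (fun s (i : Z) => B' (enum_rank s) i).
pose k0 : gmor Z S := gmx (fun s (i : Z) => R (enum_rank s) i).
(* As [r] has a right inverse, [r k = 1] follows from [r k r = r e = r]. *)
have rq : gcomp r q = gid Z.
  apply: entry_inj => i j; rewrite entry_comp_gmxr entry_id.
  have [ij|ij] := eqVneq (gdeg i) (gdeg j); last first.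
    by have [E'|//] := eqVneq i j; rewrite E' eqxx in ij.
  have /matrixP/(_ i j) := BB'; rewrite !mxE => <-.
  by rewrite sum_enum_val; apply: eq_bigr => l _; rewrite rE !mxE enum_valK.
have k0r : gcomp k0 r = e.
  apply: entry_inj => t s; rewrite entry_comp_gmxl; case: ifPn => ts;
    last by rewrite entry_deg.
  have /matrixP/(_ (enum_rank t) (enum_rank s)) := ER; rewrite !mxE !enum_rankK => ->.
  by apply: eq_bigr => i _; rewrite rE !mxE enum_rankK.
have re : gcomp r e = r.
  apply: entry_inj => i s; rewrite entry_comp rE -[in RHS]ee entry_comp.
  by apply: eq_bigr => t _; rewrite rE.
exists Z, k0, r; split=> //.
by rewrite -[gcomp r k0]gcomp_idr -rq gcompA -[gcomp (gcomp r k0) r]gcompA k0r re.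
Qed.

Definition gsum m (S : 'I_m -> gset) : gset :=
  GSet (fun x : {k : 'I_m & S k} => gdeg (tagged x)).

Lemma gcat_direct_sum m (S : 'I_m -> gcat) : exists X : gcat, is_direct_sum S X.
Proof.
exists (gsum S : gcat).
exists (fun k => gmx (fun (x : gsum S) s => (x == Tagged S s)%:R)).
exists (fun k => gmx (fun s (x : gsum S) => (x == Tagged S s)%:R)).
have iE k (x : gsum S) (s : S k) :
    entry (gmx (fun (x : gsum S) s => (x == Tagged S s)%:R)) x s = (x == Tagged S s)%:R.
  by apply: entry_gmx_deg; have [->|//] := eqVneq x _; rewrite eqxx.
have pE k (x : gsum S) (s : S k) :
    entry (gmx (fun s (x : gsum S) => (x == Tagged S s)%:R)) s x = (x == Tagged S s)%:R.
  by apply: entry_gmx_deg; have [->|//] := eqVneq x _; rewrite eqxx.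
have piE k l (t : S l) (s : S k) : \sum_(x : gsum S)
    (x == Tagged S t)%:R * (x == Tagged S s)%:R = (Tagged S t == Tagged S s)%:R :> K.
  rewrite (bigD1 (Tagged S t)) //= eqxx mul1r big1 ?addr0 // => x xt.
  by rewrite (negbTE xt) mul0r.
split=> [k|k l kl|].
- apply: entry_inj => t s; rewrite entry_comp entry_id.
  under eq_bigr do rewrite iE pE.
  by rewrite piE eq_Tagged.
- apply: entry_inj => t s; rewrite entry_comp entry0.
  under eq_bigr do rewrite iE pE.
  rewrite piE; case: eqP => // /(congr1 tag) /= lk; by rewrite lk eqxx in kl.
- apply: entry_inj => y x; rewrite entry_sum entry_id.
  rewrite (bigD1 (tag x)) //= [X in _ + X]big1 ?addr0 => [|k kx].
    rewrite entry_comp (bigD1 (tagged x)) //= big1 ?addr0 => [|s sx].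
      by rewrite iE pE; case: x => k s /=; rewrite eqxx mulr1.
    rewrite iE pE; case: x s sx => k s /= s' /negbTE ss'.
    have -> : (existT (fun i => S i) k s == Tagged (fun i => S i) s') = (s == s').
      exact: eq_Tagged.
    by rewrite [s == s']eq_sym ss' mulr0.
  rewrite entry_comp big1 // => s _; rewrite iE pE.
  case: (x =P _) kx => [->|_ _]; first by rewrite eqxx.
  by rewrite mulr0.
Qed.

Lemma gcat_abelian : is_abelian gcat.
Proof.
apply: abelian_of_regular; first exact: gcat_direct_sum.
- by move=> S T f; apply: gcat_regular.
- by move=> S e ee; apply: gcat_split.
Qed.

End GradedMatrices.

(** * Twisted tensor product of graded matrices *)

Section GradedTensor.
Variables (K : fieldType) (n : nat).
Local Notation G := 'I_n.+1.
Local Notation gset := (gset n).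
Local Notation gmor := (gmor K).
Local Notation gid := (gid K).
Implicit Types S T U V : gset.

Definition gtens S T : gset := GSet (fun x : S * T => gdeg x.1 + gdeg x.2).

Definition gone : gset := GSet (fun _ : unit => 0 : G).

Definition gtensm S S' T T' (f : gmor S S') (g : gmor T T') :
    gmor (gtens S T) (gtens S' T') :=
  gmx (fun (y : gtens S' T') (x : gtens S T) => entry f y.1 x.1 * entry g y.2 x.2).

Lemma entry_tens S S' T T' (f : gmor S S') (g : gmor T T')
    (y : gtens S' T') (x : gtens S T) :
  entry (gtensm f g) y x = entry f y.1 x.1 * entry g y.2 x.2.
Proof.
apply: entry_gmx_deg => /= ne.
have [E|ne1] := eqVneq (gdeg y.1) (gdeg x.1); last by rewrite entry_deg ?mul0r.
rewrite [entry g _ _]entry_deg ?mulr0 //; apply: contra ne => /eqP E'.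
by rewrite E E'.
Qed.

Lemma gtensm_linl S S' T T' a (f f' : gmor S S') (g : gmor T T') :
  gtensm (a *: f + f') g = a *: gtensm f g + gtensm f' g.
Proof.
by apply: entry_inj => y x; rewrite entry_lin !entry_tens entry_lin mulrDl mulrA.
Qed.

Lemma gtensm_linr S S' T T' a (f : gmor S S') (g g' : gmor T T') :
  gtensm f (a *: g + g') = a *: gtensm f g + gtensm f g'.
Proof.
by apply: entry_inj => y x; rewrite entry_lin !entry_tens entry_lin mulrDr mulrCA.
Qed.

Lemma gtensm_id S T : gtensm (gid S) (gid T) = gid (gtens S T).
Proof.
apply: entry_inj => -[t u] [t' u']; rewrite entry_tens !entry_id /= -natrM mulnb.
by rewrite xpair_eqE.
Qed.

Lemma gtensm_comp S S' S'' T T' T'' (f' : gmor S' S'') (f : gmor S S')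
    (g' : gmor T' T'') (g : gmor T T') :
  gtensm (gcomp f' f) (gcomp g' g) = gcomp (gtensm f' g') (gtensm f g).
Proof.
apply: entry_inj => y x; rewrite entry_tens !entry_comp mulr_suml.
under eq_bigr do rewrite mulr_sumr.
by rewrite pair_bigA; apply: eq_bigr => -[s t] _; rewrite !entry_tens mulrACA.
Qed.

(** The monomial morphism sending the basis vector [s] to [c s] times [phi s].
    All structure constraints have this form, so that their coherence reduces to
    identities between functions and between scalars. *)
Definition monomial S T (phi : S -> T) (c : S -> K) : gmor S T :=
  gmx (fun t s => c s * (t == phi s)%:R).

Lemma entry_monomial S T (phi : S -> T) (c : S -> K) t s :
  (forall s, gdeg (phi s) = gdeg s) -> entry (monomial phi c) t s = c s * (t == phi s)%:R.
Proof.
move=> phid; apply: entry_gmx_deg; have [->|_ _] := eqVneq t (phi s).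
  by rewrite phid eqxx.
by rewrite mulr0.
Qed.

Lemma monomial_id S : gid S = monomial id (fun=> 1).
Proof. by apply: entry_inj => t s; rewrite entry_id entry_monomial // mul1r. Qed.

Lemma comp_monomial_r S T U (f : gmor T U) (phi : S -> T) c u s :
  (forall s, gdeg (phi s) = gdeg s) ->
  entry (gcomp f (monomial phi c)) u s = entry f u (phi s) * c s.
Proof.
move=> phid; rewrite entry_comp (bigD1 (phi s)) //= entry_monomial // eqxx mulr1.
rewrite big1 ?addr0 // => t /negbTE ts.
by rewrite entry_monomial // ts !mulr0.
Qed.

Lemma comp_monomial_l S T U (phi : T -> U) (psi : U -> T) c (f : gmor S T) u s :
  (forall s, gdeg (phi s) = gdeg s) -> cancel phi psi -> cancel psi phi ->
  entry (gcomp (monomial phi c) f) u s = c (psi u) * entry f (psi u) s.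
Proof.
move=> phid phiK psiK; rewrite entry_comp (bigD1 (psi u)) //=.
rewrite entry_monomial // psiK eqxx mulr1.
rewrite big1 ?addr0 // => t tu; rewrite entry_monomial //.
case: eqP => [E|_]; last by rewrite mulr0 mul0r.
by rewrite E phiK eqxx in tu.
Qed.

Lemma comp_monomial S T U (psi : T -> U) c' (phi : S -> T) c :
  (forall s, gdeg (phi s) = gdeg s) -> (forall s, gdeg (psi s) = gdeg s) ->
  gcomp (monomial psi c') (monomial phi c) =
  monomial (psi \o phi) (fun s => c' (phi s) * c s).
Proof.
move=> phid psid; apply: entry_inj => u s; rewrite comp_monomial_r // !entry_monomial //.
  by rewrite mulrAC.
by move=> r /=; rewrite psid phid.
Qed.

Lemma tens_monomial S S' T T' (phi : S -> S') c (psi : T -> T') c' :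
  (forall s, gdeg (phi s) = gdeg s) -> (forall s, gdeg (psi s) = gdeg s) ->
  gtensm (monomial phi c) (monomial psi c') =
  monomial (fun x : gtens S T => (phi x.1, psi x.2) : gtens S' T')
    (fun x => c x.1 * c' x.2).
Proof.
move=> phid psid; apply: entry_inj => -[s' t'] [s t].
rewrite entry_tens !entry_monomial //=; last by move=> x /=; rewrite phid psid.
by rewrite mulrACA -natrM mulnb xpair_eqE.
Qed.

Lemma eq_monomial S T (phi psi : S -> T) c c' :
  phi =1 psi -> c =1 c' -> monomial phi c = monomial psi c'.
Proof. by move=> E E'; congr gmx; apply/funext => t; apply/funext => s; rewrite E E'. Qed.

Variable w : G -> G -> G -> K.
Hypothesis cw : is_cocycle w.
Hypothesis w20 : forall a c, w a 0 c = 1.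

Let w0 a b c : w a b c != 0. Proof. by have [] := cw. Qed.

Definition gassoc S T U : gmor (gtens (gtens S T) U) (gtens S (gtens T U)) :=
  @monomial (gtens (gtens S T) U) (gtens S (gtens T U))
    (fun x => (x.1.1, (x.1.2, x.2))) (fun x => w (gdeg x.1.1) (gdeg x.1.2) (gdeg x.2)).

Definition gassocV S T U : gmor (gtens S (gtens T U)) (gtens (gtens S T) U) :=
  @monomial (gtens S (gtens T U)) (gtens (gtens S T) U)
    (fun x => ((x.1, x.2.1), x.2.2))
    (fun x => (w (gdeg x.1) (gdeg x.2.1) (gdeg x.2.2))^-1).

Definition glunit S : gmor (gtens gone S) S :=
  @monomial (gtens gone S) S (fun x => x.2) (fun=> 1).

Definition grunit S : gmor (gtens S gone) S :=
  @monomial (gtens S gone) S (fun x => x.1) (fun=> 1).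

Lemma gassoc_deg S T U (x : gtens (gtens S T) U) :
  gdeg ((x.1.1, (x.1.2, x.2)) : gtens S (gtens T U)) = gdeg x.
Proof. by rewrite /= addrA. Qed.

Lemma gassocV_deg S T U (x : gtens S (gtens T U)) :
  gdeg (((x.1, x.2.1), x.2.2) : gtens (gtens S T) U) = gdeg x.
Proof. by rewrite /= addrA. Qed.

Lemma glunit_deg S (x : gtens gone S) : gdeg x.2 = gdeg x.
Proof. by rewrite /= add0r. Qed.

Lemma grunit_deg S (x : gtens S gone) : gdeg x.1 = gdeg x.
Proof. by rewrite /= addr0. Qed.

Lemma gassocK S T U : gcomp (gassocV S T U) (gassoc S T U) = gid _.
Proof.
rewrite comp_monomial ?monomial_id; [|exact: gassoc_deg|exact: gassocV_deg].
by apply: eq_monomial => [[[s t] u]|[[s t] u]] //=; rewrite mulVf.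
Qed.

Lemma gassocVK S T U : gcomp (gassoc S T U) (gassocV S T U) = gid _.
Proof.
rewrite comp_monomial ?monomial_id; [|exact: gassocV_deg|exact: gassoc_deg].
by apply: eq_monomial => [[s [t u]]|[s [t u]]] //=; rewrite divff.
Qed.

Lemma glunit_iso S : @is_iso _ (gcat K n) _ _ (glunit S).
Proof.
pose inv := @monomial S (gtens gone S) (fun x => (tt, x)) (fun=> 1).
have d (s : S) : gdeg ((tt, s) : gtens gone S) = gdeg s by rewrite /= add0r.
suff H : gcomp inv (glunit S) = gid _ /\ gcomp (glunit S) inv = gid _ by exists inv.
rewrite !comp_monomial ?monomial_id //; try exact: glunit_deg.
by split; [apply: eq_monomial => [[[] s]|[[] s]]|apply: eq_monomial => s]; rewrite /= ?mulr1.
Qed.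

Lemma grunit_iso S : @is_iso _ (gcat K n) _ _ (grunit S).
Proof.
pose inv := @monomial S (gtens S gone) (fun x => (x, tt)) (fun=> 1).
have d (s : S) : gdeg ((s, tt) : gtens S gone) = gdeg s by rewrite /= addr0.
suff H : gcomp inv (grunit S) = gid _ /\ gcomp (grunit S) inv = gid _ by exists inv.
rewrite !comp_monomial ?monomial_id //; try exact: grunit_deg.
by split; [apply: eq_monomial => [[s []]|[s []]]|apply: eq_monomial => s]; rewrite /= ?mulr1.
Qed.

Lemma gassoc_nat S S' T T' U U' (f : gmor S S') (g : gmor T T') (h : gmor U U') :
  gcomp (gassoc S' T' U') (gtensm (gtensm f g) h) =
  gcomp (gtensm f (gtensm g h)) (gassoc S T U).
Proof.
apply: entry_inj => -[s' [t' u']] [[s t] u].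
rewrite (comp_monomial_l (psi := fun x : gtens S' (gtens T' U') =>
  ((x.1, x.2.1), x.2.2) : gtens (gtens S' T') U'));
  [|exact: gassoc_deg|by case=> [[]]|by case=> ? []].
rewrite comp_monomial_r; last exact: gassoc_deg.
rewrite !entry_tens /=.
have [->|ne] := eqVneq (gdeg s') (gdeg s); last by rewrite (entry_deg _ ne) !mul0r mulr0.
have [->|ne] := eqVneq (gdeg t') (gdeg t); last first.
  by rewrite (entry_deg _ ne) !(mul0r, mulr0).
have [->|ne] := eqVneq (gdeg u') (gdeg u); last first.
  by rewrite (entry_deg _ ne) !(mul0r, mulr0).
by ring.
Qed.

Lemma glunit_nat S T (f : gmor S T) :
  gcomp (glunit T) (gtensm (gid gone) f) = gcomp f (glunit S).
Proof.
apply: entry_inj => t [[] s].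
rewrite (comp_monomial_l (psi := fun x : T => (tt, x) : gtens gone T));
  [|exact: glunit_deg|by case=> [[]]|by []].
rewrite comp_monomial_r; last exact: glunit_deg.
by rewrite entry_tens entry_id !mul1r mulr1.
Qed.

Lemma grunit_nat S T (f : gmor S T) :
  gcomp (grunit T) (gtensm f (gid gone)) = gcomp f (grunit S).
Proof.
apply: entry_inj => t [s []].
rewrite (comp_monomial_l (psi := fun x : T => (x, tt) : gtens T gone));
  [|exact: grunit_deg|by case=> [? []]|by []].
rewrite comp_monomial_r; last exact: grunit_deg.
by rewrite entry_tens entry_id mul1r.
Qed.

Lemma gpentagon S T U V :
  gcomp (gassoc S T (gtens U V)) (gassoc (gtens S T) U V) =
  gcomp (gcomp (gtensm (gid S) (gassoc T U V)) (gassoc S (gtens T U) V))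
    (gtensm (gassoc S T U) (gid V)).
Proof.
rewrite !monomial_id /gassoc !tens_monomial //; try exact: gassoc_deg.
rewrite !comp_monomial //; try exact: gassoc_deg.
- apply: eq_monomial => [[[[s t] u] v]|[[[s t] u] v]] //=; have [_ wc] := cw.
  by rewrite mul1r mulr1 [LHS]mulrC -wc.
- by move=> x; rewrite /= !addrA.
- by move=> x; rewrite /= !addrA.
- by move=> x; rewrite /= !addrA.
Qed.

Lemma gtriangle S T :
  gcomp (gtensm (gid S) (glunit T)) (gassoc S gone T) = gtensm (grunit S) (gid T).
Proof.
rewrite !monomial_id /gassoc /glunit /grunit !tens_monomial //.
- rewrite comp_monomial; last 2 first.
  + exact: gassoc_deg.
  + by move=> x /=; rewrite add0r.
  by apply: eq_monomial => [[[s []] t]|[[s []] t]] //=; rewrite w20 !mul1r.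
- exact: grunit_deg.
- exact: glunit_deg.
Qed.

Definition gmon : monCat K :=
  @MonCat K (gcat K n) gtens gtensm gone gassoc gassocV glunit grunit
    gtensm_linl gtensm_linr gtensm_id gtensm_comp gassocK gassocVK
    glunit_iso grunit_iso gassoc_nat glunit_nat grunit_nat gpentagon gtriangle.

End GradedTensor.

(** * Fusion structure of the twisted category *)

Section GradedFusion.
Variables (K : fieldType) (n : nat).
Local Notation G := 'I_n.+1.
Variable w : G -> G -> G -> K.
Hypothesis cw : is_cocycle w.
Hypothesis w10 : forall b c, w 0 b c = 1.
Hypothesis w20 : forall a c, w a 0 c = 1.
Hypothesis w30 : forall a b, w a b 0 = 1.
Local Notation M := (gmon cw w20).

(** The one-dimensional space in degree [a]. *)
Definition line (a : G) : gset n := GSet (fun _ : unit => a).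

Lemma gset_nonzero (S : gset n) (s : S) : ~ is_zero (S : gcat K n).
Proof.
move=> /(congr1 (fun f => entry f s s)); rewrite entry_id entry0 eqxx => /eqP.
by rewrite oner_eq0.
Qed.

(** A monomorphism into a line is zero, so that its source vanishes, or has a
    nonzero entry, which gives a section. *)
Lemma line_simple a : is_simple (line a : gcat K n).
Proof.
split=> [|S f fm]; first exact: (gset_nonzero (tt : line a)).
have [f0|/eqP f0] := pselect (f = 0).
  by left; apply: fm; rewrite f0 !comp0m.
right; have [s fs] : exists s, entry f tt s != 0.
  apply: contrapT => nf; case/eqP: f0; apply: entry_inj => -[] s; rewrite entry0.
  by apply: contrapT => /eqP ne; apply: nf; exists s.
pose g : gmor K (line a) S := gmx (fun s' _ => (entry f tt s)^-1 * (s' == s)%:R).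
have sd : gdeg s = a.
  by apply/esym/eqP; apply: contraNT fs => ne; rewrite entry_deg.
have fg : gcomp f g = gid K _.
  apply: entry_inj => -[] []; rewrite entry_comp entry_id eqxx (bigD1 s) //=.
  rewrite entry_gmx sd eqxx /= eqxx mulr1 mulfV // big1 ?addr0 // => s' /negbTE s's.
  by rewrite entry_gmx s's !(mulr0, if_same).
exists g; split=> //; apply: fm; rewrite compmA.
by rewrite (fg : f \oc (g : @mor _ (gcat K n) _ _) = idm _) compm_idl compm_idr.
Qed.

Lemma line_hom0 a b (f : gmor K (line a) (line b)) : a != b -> f = 0.
Proof. by move=> ab; apply: entry_inj => -[] []; rewrite entry0 entry_deg // eq_sym. Qed.

Lemma line_inj a b : isomorphic (line a : gcat K n) (line b) -> a = b.
Proof.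
move=> [f [g [gf _]]]; apply/eqP/negPn/negP => ab.
have [+ _] := line_simple a; apply; rewrite /is_zero -gf.
by rewrite (line_hom0 f ab) compm0.
Qed.

Lemma gcat_semisimple : is_semisimple (gcat K n).
Proof.
move=> S; exists #|S|, (fun k => line (gdeg (enum_val k))); split.
  by move=> k; apply: line_simple.
exists (fun k => gmx (fun s _ => (s == enum_val k)%:R)).
exists (fun k => gmx (fun _ s => (s == enum_val k)%:R)).
have iE k (s : S) u : entry (gmx (fun (s : S) (_ : line (gdeg (enum_val k))) =>
    (s == enum_val k)%:R)) s u = (s == enum_val k)%:R :> K.
  by apply: entry_gmx_deg; have [->|//] := eqVneq s _; rewrite eqxx.
have pE k (s : S) u : entry (gmx (fun (_ : line (gdeg (enum_val k))) (s : S) =>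
    (s == enum_val k)%:R)) u s = (s == enum_val k)%:R :> K.
  by apply: entry_gmx_deg; have [->|//] := eqVneq s _; rewrite eqxx.
have piE (s t : S) : \sum_x (x == s)%:R * (x == t)%:R = (s == t)%:R :> K.
  rewrite (bigD1 s) //= eqxx mul1r big1 ?addr0 // => x /negbTE xs.
  by rewrite xs mul0r.
split=> [k|k l kl|].
- apply: entry_inj => -[] []; rewrite entry_comp entry_id eqxx.
  by under eq_bigr do rewrite iE pE; rewrite piE eqxx.
- apply: entry_inj => -[] []; rewrite entry_comp entry0.
  under eq_bigr do rewrite iE pE; rewrite piE.
  by rewrite (inj_eq enum_val_inj) eq_sym (negbTE kl).
- apply: entry_inj => t s; rewrite entry_sum entry_id (bigD1 (enum_rank s)) //=.
  rewrite [X in _ + X]big1 ?addr0 => [|k ks]; rewrite entry_comp (bigD1 tt) //=.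
    rewrite [X in _ + X]big1 ?addr0 => [|[] //]; rewrite iE pE enum_rankK eqxx mulr1 //.
  rewrite [X in _ + X]big1 ?addr0 => [|[] //]; rewrite iE pE.
  case: (s =P enum_val k) => [E|_]; last by rewrite mulr0.
  by rewrite E enum_valK eqxx in ks.
Qed.

(** A basis vector of [S] spans a line that is a retract of [S]. *)
Lemma gcat_simple_line (S : gcat K n) : is_simple S ->
  exists a, isomorphic S (line a : gcat K n).
Proof.
move=> [S0 Ss].
have [s _] : exists s : S, True.
  apply: contrapT => nS; apply: S0; apply: entry_inj => s.
  by case: nS; exists s.
pose i : gmor K (line (gdeg s)) S := gmx (fun s' _ => (s' == s)%:R).
pose p : gmor K S (line (gdeg s)) := gmx (fun _ s' => (s' == s)%:R).
have pi : gcomp p i = gid K _.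
  apply: entry_inj => -[] []; rewrite entry_comp entry_id eqxx (bigD1 s) //=.
  rewrite !entry_gmx /= !eqxx mul1r big1 ?addr0 // => s' /negbTE s's.
  by rewrite !entry_gmx s's !if_same mul0r.
have im : is_mono (i : @mor _ (gcat K n) (line (gdeg s)) S).
  move=> Z f g E; rewrite -[f]compm_idl -[g]compm_idl.
  by rewrite -(pi : (p : @mor _ (gcat K n) _ _) \oc i = idm _) -!compmA E.
exists (gdeg s); apply: isomorphic_sym; exists i.
by have [/(gset_nonzero (tt : line (gdeg s)))|] := Ss _ _ im.
Qed.

Lemma gcat_finite : finitely_many_simples (gcat K n).
Proof. by exists n.+1, line => X; apply: gcat_simple_line. Qed.

Let w0 a b c : w a b c != 0. Proof. by have [] := cw. Qed.

(** The cocycle identity at [(a, - a, a, - a)]. *)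
Lemma w_dual a : w a (- a) a * w (- a) a (- a) = 1.
Proof.
have [_ wc] := cw; have := wc a (- a) a (- a).
by rewrite addNr subrr w10 w20 w30 !mulr1 mulrC.
Qed.

(** The pairing of a basis with the same basis in opposite degrees; the scalar
    in [ev] compensates the associator in the first zigzag identity, and
    [w_dual] makes it compensate the one in the second. *)
Lemma gmon_left_dual (S S' : gset n) (phi : S' -> S) (psi : S -> S') :
  cancel phi psi -> cancel psi phi -> (forall s, gdeg (psi s) = - gdeg s) ->
  is_left_dual (S : M) S'.
Proof.
move=> phiK psiK psid.
have phid s : gdeg s = - gdeg (phi s) by rewrite -psid phiK.
pose ep (s : S) := (w (gdeg s) (- gdeg s) (gdeg s))^-1.
pose ev : gmor K (gtens S' S) (gone n) :=
  gmx (fun _ (x : gtens S' S) => (phi x.1 == x.2)%:R * ep x.2).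
pose co : gmor K (gone n) (gtens S S') :=
  gmx (fun (x : gtens S S') _ => (phi x.2 == x.1)%:R).
have evE (x : gtens S' S) : entry ev tt x = (phi x.1 == x.2)%:R * ep x.2.
  apply: entry_gmx_deg => /=; have [<-|_] := eqVneq (phi x.1) x.2; last by rewrite mul0r.
  by rewrite phid addNr eqxx.
have coE (x : gtens S S') : entry co x tt = (phi x.2 == x.1)%:R.
  apply: entry_gmx_deg => /=; have [<-|//] := eqVneq (phi x.2) x.1.
  by rewrite phid subrr eqxx.
exists ev, co; split.
- suff : gcomp (gcomp (gcomp (grunit K S) (gtensm (gid K S) ev)) (gassoc w S S' S))
            (gtensm co (gid K S)) = glunit K S by [].
  apply: entry_inj => t [[] s].
  rewrite [RHS]entry_monomial; last exact: glunit_deg.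
  rewrite mul1r entry_comp (bigD1 ((s, psi s), s)) //= [X in _ + X]big1 ?addr0.
    rewrite comp_monomial_r; last exact: gassoc_deg.
    rewrite (comp_monomial_l (psi := fun x : S => (x, tt) : gtens S (gone n)));
      [|exact: grunit_deg|by case=> ? []|by []].
    rewrite !entry_tens /= !entry_id evE coE /= psiK !eqxx !mul1r !mulr1 psid.
    by rewrite -mulrA mulVf ?mulr1.
  move=> [[a b] c] ne; rewrite comp_monomial_r; last exact: gassoc_deg.
  rewrite (comp_monomial_l (psi := fun x : S => (x, tt) : gtens S (gone n)));
    [|exact: grunit_deg|by case=> ? []|by []].
  rewrite !entry_tens /= !entry_id evE coE /=.
  have [E1|_] := eqVneq c s; last by rewrite !mulr0.
  have [E2|_] := eqVneq (phi b) a; last by rewrite mul0r mulr0.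
  have [E3|_] := eqVneq (phi b) c; last by rewrite !(mul0r, mulr0).
  by move: ne; rewrite -E2 E3 E1 -[b]phiK E3 E1 eqxx.
- suff : gcomp (gcomp (gcomp (glunit K S') (gtensm ev (gid K S'))) (gassocV w S' S S'))
            (gtensm (gid K S') co) = grunit K S' by [].
  apply: entry_inj => t [s []].
  rewrite [RHS]entry_monomial; last exact: grunit_deg.
  rewrite mul1r entry_comp (bigD1 (s, (phi s, s))) //= [X in _ + X]big1 ?addr0.
    rewrite comp_monomial_r; last exact: gassocV_deg.
    rewrite (comp_monomial_l (psi := fun x : S' => (tt, x) : gtens (gone n) S'));
      [|exact: glunit_deg|by case=> [[]]|by []].
    rewrite !entry_tens /= !entry_id evE coE /= !eqxx !mul1r !mulr1 phid /ep.
    by rewrite [_^-1 * _]mulrC -mulrA -invfM w_dual invr1 mulr1.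
  move=> [a [b c]] ne; rewrite comp_monomial_r; last exact: gassocV_deg.
  rewrite (comp_monomial_l (psi := fun x : S' => (tt, x) : gtens (gone n) S'));
    [|exact: glunit_deg|by case=> [[]]|by []].
  rewrite !entry_tens /= !entry_id evE coE /=.
  have [E1|_] := eqVneq a s; last by rewrite mul0r mulr0.
  have [E2|_] := eqVneq (phi c) b; last by rewrite !mulr0.
  have [E3|_] := eqVneq (phi a) b; last by rewrite !(mul0r, mulr0).
  by move: ne; rewrite -E3 E1 -[c]phiK E2 -E3 E1 phiK eqxx.
Qed.

Lemma gmon_rigid : is_rigid M.
Proof.
move=> S; pose S' : gset n := GSet (fun s : S => - gdeg s).
split; exists S'.
  by apply: (gmon_left_dual (phi := id : S' -> S) (psi := id)).
by apply: (gmon_left_dual (phi := id : S -> S') (psi := id)) => // s; rewrite /= opprK.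
Qed.

Lemma gmon_fusion : is_fusion M.
Proof.
split; [exact: gcat_abelian|exact: gcat_semisimple|exact: gcat_finite|
  exact: gmon_rigid|exact: (line_simple 0)].
Qed.

Definition gfus : fusionCat K := FusionCat gmon_fusion.

Definition line_mul a b c : gmor K (gtens (line a) (line b)) (line c) :=
  gmx (fun _ _ => 1).

Lemma entry_line_mul a b c u v : c = a + b -> entry (line_mul a b c) u v = 1.
Proof. by move=> ->; rewrite entry_gmx eqxx. Qed.

Lemma sum_unit (F : unit -> K) : \sum_u F u = F tt.
Proof. by rewrite (big_pred1 tt) // => -[]. Qed.

Lemma gfus_skeleton :
  @skeleton K gfus n w line (fun a b c => line_mul a b c).
Proof.
split=> [a|a b|S Ss|a b|a b c].
- exact: line_simple.
- exact: line_inj.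
- exact: gcat_simple_line.
- pose inv : gmor K (line (a + b)) (gtens (line a) (line b)) := gmx (fun _ _ => 1).
  suff : gcomp inv (line_mul a b (a + b)) = gid K _ /\
         gcomp (line_mul a b (a + b)) inv = gid K _ by exists inv.
  split; apply: entry_inj.
    move=> [[] []] [[] []]; rewrite entry_comp entry_id eqxx sum_unit.
    by rewrite !entry_gmx /= eqxx mul1r.
  move=> [] []; rewrite entry_comp entry_id eqxx (bigD1 ((tt, tt) : gtens (line a) (line b))) //=.
  by rewrite big1 ?addr0 => [|[[] []] //]; rewrite !entry_gmx /= eqxx mul1r.
suff : gcomp (gcomp (line_mul a (b + c) (a + (b + c)))
           (gtensm (gid K (line a)) (line_mul b c (b + c))))
         (gassoc w (line a) (line b) (line c)) =
       w a b c *: gcomp (line_mul (a + b) c (a + (b + c)))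
         (gtensm (line_mul a b (a + b)) (gid K (line c))) by [].
apply: entry_inj => -[] [[[] []] []]; rewrite comp_monomial_r; last exact: gassoc_deg.
rewrite -[_ *: _]addr0 entry_lin entry0 addr0 !entry_comp.
rewrite (bigD1 ((tt, tt) : gtens (line a) (line (b + c)))) //= big1 ?addr0 => [|[[] []] //].
rewrite (bigD1 ((tt, tt) : gtens (line (a + b)) (line c))) //= big1 ?addr0 => [|[[] []] //].
rewrite !entry_tens !entry_line_mul // ?addrA // !entry_id ?eqxx /=.
by rewrite !mul1r !mulr1.
Qed.

End GradedFusion.

(** * The classification *)

Lemma closed_prim_root (K : closedFieldType) (N : nat) :
  (0 < N)%N -> N%:R != 0 :> K -> exists z : K, N.-primitive_root z.
Proof.
move=> N0 charN; pose p : {poly K} := 'X^N - 1.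
have [r Dp] := closed_field_poly_normal p.
rewrite (monicP _) ?monicXnsubC // scale1r in Dp.
have rn1 : all N.-unity_root r by apply/allP=> z; rewrite -root_prod_XsubC -Dp.
have sz : (N < (size r).+1)%N.
  by rewrite -(size_prod_XsubC r id) -Dp size_XnsubC.
have [|z] := hasP (has_prim_root N0 rn1 _ sz); last by exists z.
by rewrite -separable_prod_XsubC -Dp separable_Xn_sub_1.
Qed.

Section Classification.
Variables (K : closedFieldType) (n : nat) (z : K).
Hypothesis zP : n.+1.-primitive_root z.
Local Notation G := 'I_n.+1.

Lemma expr_prim_inj (a b : G) : z ^+ a = z ^+ b -> a = b.
Proof.
move/eqP; rewrite (eq_prim_root_expr zP) => /eqP; rewrite !modn_small // => E.
exact: val_inj.
Qed.

Lemma expr_Zp_mul (a p : G) : z ^+ (ZN_mul (N := n.+1) (ZN_mul (N := n.+1) p p) a) =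
  (z ^+ a) ^+ (p * p).
Proof.
by rewrite -exprM /= prim_expr_mod // -(prim_expr_mod zP) modnMml prim_expr_mod // mulnC.
Qed.

(** Collecting the exponents over all representatives of the class and all their
    types avoids choosing either. *)
Definition class_invariant (c : fusionCat K -> Prop) : set (ZN n.+1) :=
  fun a => exists C, c = mon_class C /\ @has_type K C n (z ^+ (a : G)).

(** Members of one class have the same types, and the types of one category form
    an orbit under z |-> z^(p^2). *)
Lemma class_invariantE (C : fusionCat K) (a : G) : @has_type K C n (z ^+ a) ->
  class_invariant (mon_class C) = square_orbit (N := n.+1) a.
Proof.
move=> Ca; apply/seteqP; split=> b /=.
- move=> [C' [CC' C'b]].
  have C'C' : mon_class C' C' := (has_type_equivalent C'b C'b).
  rewrite -CC' in C'C'; have C'a := has_type_transport C'C' Ca.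
  have [p [q [pq E]]] := has_type_unique C'a C'b.
  exists p; first by exists q.
  by apply: expr_prim_inj; rewrite expr_Zp_mul -E.
- move=> [p [q pq] <-]; exists C; split=> //.
  rewrite expr_Zp_mul; exact: has_type_square pq Ca.
Qed.

Lemma has_type_exponent (C : fusionCat K) : @has_VecZN_rules K n.+1 C ->
  exists a : G, @has_type K C n (z ^+ a).
Proof.
move=> /rules_has_type[t Ct]; have [tN _] := Ct.
by have [i tE] := prim_rootP zP tN; exists i; rewrite -tE.
Qed.

Lemma type_realised (a : G) : exists C : fusionCat K, @has_type K C n (z ^+ a).
Proof.
have zaN : (z ^+ a) ^+ n.+1 = 1 by rewrite exprAC (prim_expr_order zP) expr1n.
have cw := std3_cocycle zaN.
have w10 (b c : G) : std3 (z ^+ a) 0 b c = 1 :> K by rewrite /std3 mul0n.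
have w20 (b c : G) : std3 (z ^+ a) b 0 c = 1 :> K.
  by rewrite /std3 add0n divn_small ?muln0.
have w30 (b c : G) : std3 (z ^+ a) b c 0 = 1 :> K.
  by rewrite /std3 addn0 divn_small ?muln0.
exists (gfus cw w10 w20 w30); split=> //.
by exists (@line n), (@line_mul K n); apply: gfus_skeleton.
Qed.

Lemma class_invariant_bij :
  bijection_between (@VecZN_classes K n.+1) (square_orbits n.+1) class_invariant.
Proof.
split=> [c [C Cr ->]|c c' [C Cr ->] [C' Cr' ->]|_ [a _ <-]].
- have [a Ca] := has_type_exponent Cr; exists a => //.
  by rewrite (class_invariantE Ca).
- have [a Ca] := has_type_exponent Cr => E.
  have : class_invariant (mon_class C) a by exists C.
  rewrite E => -[C'' [-> C''a]]; apply/funext => D; apply/propext.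
  split=> CD; first exact: has_type_equivalent C''a (has_type_transport CD Ca).
  exact: has_type_equivalent Ca (has_type_transport CD C''a).
- have [C Ca] := type_realised a; exists (mon_class C); last exact: class_invariantE.
  by exists C => //; apply: has_type_rules Ca.
Qed.

End Classification.

Theorem mainTheorem7 (R : realType) (N : nat) (hN : (0 < N)%N) :
  exists f : (fusionCat R[i] -> Prop) -> set (ZN N),
    bijection_between (VecZN_classes R[i] N) (square_orbits N) f.
Proof.
case: N hN => // n _.
have [z zP] : exists z : R[i], n.+1.-primitive_root z.
  by apply: closed_prim_root => //; rewrite Num.Theory.pnatr_eq0.
by exists (class_invariant z); apply: class_invariant_bij.
Qed.
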